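(* Let $(e_i)$ be an unconditional basis for a Banach space $E$, and let $J(e_i)$ be the James space over $(e_i)$. Then $c_0$ coarsely embeds into $J(e_i)$ if and only if $c_0$ linearly embeds into $J(e_i)$.
   Context: The James space $J(e_i)$ over $(e_i)$ is the completion of $c_{00}$ (with unit vectors denoted $(u_i)$) under the norm $$\Big\|\sum a_iu_i\Big\|_{J(e_i)}=\sup\Big\|\sum_{i=1}^k\Big(\sum_{j=p(i)}^{q(i)}a_j\Big)e_{p(i)}\Big\|_E,$$ where the supremum is over all $k\in\mathbb{N}$ and $1\le p(1)\le q(1)<p(2)\le q(2)<\cdots<p(k)\le q(k)$. A map $\phi:X_1\to X_2$ between metric spaces is a coarse embedding if there are nondecreasing functions $\rho,\omega:[0,\infty)\to[0,\infty)$ with $\lim_{t\to\infty}\rho(t)=\infty$ and $\rho(d(x,y))\le d(\phi(x),\phi(y))\le\omega(d(x,y))$ for all $x,y\in X_1$. ''Linearly embeds'' means is linearly isomorphic to a closed subspace. *)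

(* Defs.v *)
From HB Require Import structures.
From mathcomp Require Import all_boot all_order all_algebra.
From mathcomp Require Import all_classical all_reals all_analysis.

Set Implicit Arguments.
Unset Strict Implicit.
Unset Printing Implicit Defensive.

Import Order.TTheory GRing.Theory Num.Theory.
Import numFieldNormedType.Exports.

Local Open Scope classical_set_scope.
Local Open Scope ring_scope.

Section c0_space.
Context {R : realType}.

Definition null_seq : {pred nat -> R} :=
  fun x => `[< x n @[n --> \oo] --> (0 : R) >].

Lemma null_seqP (x : nat -> R) :
  reflect (x n @[n --> \oo] --> (0 : R)) (x \in null_seq).
Proof. exact: asboolP. Qed.

Lemma null_seq_submod_closed : submod_closed null_seq.
Proof.
split; first by apply/null_seqP; exact: cvg_cst.
move=> k x y /null_seqP x0 /null_seqP y0; apply/null_seqP.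
have -> : (0 : R) = k * 0 + 0 by rewrite mulr0 addr0.
by apply: cvgD => //; apply: cvgMr => //; exact: cvg_cst.
Qed.

HB.instance Definition _ :=
  GRing.isSubmodClosed.Build R (nat -> R) null_seq null_seq_submod_closed.

Record c0 : Type := C0 { c0_val :> nat -> R ; c0_valP : c0_val \in null_seq }.

HB.instance Definition _ := [isSub for c0_val].
HB.instance Definition _ := [Choice of c0 by <:].
HB.instance Definition _ := [SubChoice_isSubLmodule of c0 by <:].

Definition c0_norm (x : c0) : R := sup (range (fun n => `|x n|)).

Lemma c0_has_sup (x : c0) : has_sup (range (fun n => `|x n|)).
Proof.
split; first by exists `|x 0%N|; exists 0%N.
have /null_seqP/cvgP/cvg_seq_bounded[M [_ /(_ (M + 1))]] := c0_valP x.
rewrite ltrDl ltr01 => /(_ isT) xM.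
by exists (M + 1) => _ [n _ <-]; exact: xM.
Qed.

Lemma c0_norm_ub (x : c0) n : `|x n| <= c0_norm x.
Proof. by apply: ub_le_sup; [case: (c0_has_sup x)|exists n]. Qed.

Lemma c0_norm_le (x : c0) M : (forall n, `|x n| <= M) -> c0_norm x <= M.
Proof.
by move=> xM; apply: ge_sup => [|_ [n _ <-]//]; case: (c0_has_sup x).
Qed.

Lemma c0_normD x y : c0_norm (x + y) <= c0_norm x + c0_norm y.
Proof.
apply: c0_norm_le => n.
by rewrite (le_trans (ler_normD _ _))// lerD// c0_norm_ub.
Qed.

Lemma c0_normZ (k : R) x : c0_norm (k *: x) = `|k| * c0_norm x.
Proof.
apply/eqP; rewrite eq_le; apply/andP; split.
  by apply: c0_norm_le => n; rewrite normrM ler_wpM2l// c0_norm_ub.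
have [->|k0] := eqVneq k 0.
  rewrite normr0 mul0r; apply: le_trans (c0_norm_ub _ 0); exact: normr_ge0.
rewrite -ler_pdivlMl ?normr_gt0//; apply: c0_norm_le => n.
by rewrite ler_pdivlMl ?normr_gt0// -normrM (c0_norm_ub (k *: x)).
Qed.

Lemma c0_norm0_eq0 x : c0_norm x = 0 -> x = 0.
Proof.
move=> x0; apply/val_inj/funext => n; apply/eqP.
by rewrite -normr_le0 -x0 c0_norm_ub.
Qed.

HB.instance Definition _ :=
  Lmodule_isNormed.Build R c0 c0_normD c0_normZ c0_norm0_eq0.

End c0_space.
Arguments c0 : clear implicits.

Section bases.
Context {R : realType} {E : normedModType R}.

Definition schauder_basis (e : nat -> E) : Prop :=
  forall x : E, exists! a : nat -> R,
    series (fun i => a i *: e i) @ \oo --> x.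

Definition unconditionally_cvg (v : nat -> E) : Prop :=
  forall s : nat -> nat, bijective s -> cvgn (series (v \o s)).

Definition unconditional_basis (e : nat -> E) : Prop :=
  schauder_basis e /\
  forall (x : E) (a : nat -> R), series (fun i => a i *: e i) @ \oo --> x ->
    unconditionally_cvg (fun i => a i *: e i).

End bases.

Section james.
Context {R : realType} {E : normedModType R}.

(* Indices start at 0 here, so that u_0 and e_0 are the first vectors.
   The supremum is taken in the extended reals and is finite when a has finite
   support; the empty family (k = 0) contributes the value 0. *)
Definition james_norm (e : nat -> E) (a : nat -> R) : \bar R :=
  ereal_sup [set z | exists (k : nat) (p q : nat -> nat),
    [/\ forall i, (i < k)%N -> (p i <= q i)%N,
        forall i, (i.+1 < k)%N -> (q i < p i.+1)%N &
        z = `| \sum_(i < k) (\sum_(p i <= j < (q i).+1) a j) *: e (p i) |%:E]].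

(* J, with unit vectors u, is a completion of c_00 under the James norm: the
   linear map sending (a_0, ..., a_(n-1), 0, ...) to the sum of the a_i u_i is
   isometric with dense range in the Banach space J. This determines J up to
   isometric isomorphism. *)
Definition is_james_space (e : nat -> E) (J : completeNormedModType R)
    (u : nat -> J) : Prop :=
  (forall (n : nat) (a : nat -> R),
     `| \sum_(i < n) a i *: u i |%:E
       = james_norm e (fun i => if (i < n)%N then a i else 0)) /\
  dense [set x : J | exists (n : nat) (a : nat -> R),
     x = \sum_(i < n) a i *: u i].

End james.

Section embeddings.
Context {R : realType} (X Y : normedModType R).

(* The moduli are maps [0, oo) -> [0, oo): only their values at t >= 0 are
   constrained and used. *)
Definition coarse_embedding (phi : X -> Y) : Prop :=
  exists rho omega : R -> R,
    [/\ forall t, 0 <= t -> 0 <= rho t /\ 0 <= omega t,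
        forall s t, 0 <= s -> s <= t -> rho s <= rho t /\ omega s <= omega t,
        rho t @[t --> +oo] --> +oo &
        forall x y, rho `|x - y| <= `|phi x - phi y| <= omega `|x - y|].

Definition coarsely_embeds : Prop := exists phi : X -> Y, coarse_embedding phi.

Definition linearly_embeds : Prop :=
  exists (T : {linear X -> Y}) (S : Y -> X),
    [/\ continuous T, closed (range T), cancel T S &
        {within range T, continuous S}].

End embeddings.

(* Main.v *)
From HB Require Import structures.
Require Import Defs.
From mathcomp Require Import all_boot all_order all_algebra.
From mathcomp Require Import all_classical all_reals all_analysis.
From mathcomp Require Import ring lra zify.

(* If some a of finite James norm has tails that do not tend to 0, one cuts a
   into blocks z_k separated by gaps, with sums so small that they are
   negligible even after multiplication by the norms of the earlier e_p. A sum
   of a over an interval then splits into a first block, a last block and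
   negligible complete blocks, whence |sum w_k z_k| <= C max |w_k| and (z_k)
   spans c_0.

   Otherwise (u_i) is boundedly complete, and bounded sequences have coordinatewise
   ultralimits that stay in the space. For x in {0,1}^N let f_x(n_1,...,n_r) be
   the image under the coarse map of the sum of the x restricted to [0,n_l). As in
   Kalton's work on interlacing graphs, |f_x(n) - f_x(m)| is bounded
   independently of r if n_1 < m_1 < n_2 < m_2 < .... By uncountability there are
   x <> y for which the iterated limits of f_x and f_y, and the masses that escape
   to infinity along these limits, almost agree. For generic n the vector
   f_x(n) - f_y(n) is then a sum of blocks with almost no mass, and comparison
   with f_x(m) - f_y(m) for an interlaced generic m bounds its norm
   independently of r, whereas the corresponding points of c_0 are at distance
   r. *)

Set Implicit Arguments.
Unset Strict Implicit.
Unset Printing Implicit Defensive.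

Import Order.TTheory GRing.Theory Num.Theory.
Import numFieldNormedType.Exports.

Local Open Scope classical_set_scope.
Local Open Scope ring_scope.

(** * Interval sums, heads and tails of scalar sequences *)

Section sequences_of_scalars.
Context {R : realType}.
Implicit Types a b : nat -> R.

Definition isum a (p q : nat) : R := \sum_(p <= j < q) a j.

Definition headn (n : nat) a : nat -> R := fun j => if (j < n)%N then a j else 0.
Definition tailn (n : nat) a : nat -> R := fun j => if (j < n)%N then 0 else a j.

Lemma isumD a b p q : isum (a \+ b) p q = isum a p q + isum b p q.
Proof. by rewrite /isum -big_split. Qed.

Lemma isumB a b p q : isum (a \- b) p q = isum a p q - isum b p q.
Proof. by rewrite /isum -sumrN -big_split. Qed.

Lemma isumZ (k : R) a p q : isum (k \o* a) p q = k * isum a p q.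
Proof. by rewrite /isum mulr_sumr; apply: eq_bigr => j _; rewrite /= mulrC. Qed.

Lemma isum_geq a p q : (q <= p)%N -> isum a p q = 0.
Proof. by move=> qp; rewrite /isum big_geq. Qed.

Lemma isum_cat a p q r : (p <= q)%N -> (q <= r)%N ->
  isum a p r = isum a p q + isum a q r.
Proof. by move=> pq qr; rewrite /isum (big_cat_nat pq qr). Qed.

Lemma isum_headn n a p q : isum (headn n a) p q = isum a p (minn q n).
Proof.
rewrite /isum /headn -big_mkcond/=.
have [qn|/ltnW nq] := leqP q n.
  rewrite [LHS]big_seq_cond [RHS]big_seq_cond; apply: eq_bigl => j.
  by rewrite mem_index_iota; case: (j < q)%N / ltnP => jq;
    rewrite ?andbF//= (leq_trans jq qn) andbT.
by rewrite (big_nat_widen p n q).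
Qed.

Lemma headn_headn m n a : headn m (headn n a) = headn (minn m n) a.
Proof. by apply/funext => j; rewrite /headn leq_min; do 2!case: (_ < _)%N. Qed.

Lemma tailn_headn m n a : tailn m (headn n a) = headn n (tailn m a).
Proof. by apply/funext => j; rewrite /headn /tailn; do 2!case: (_ < _)%N. Qed.

Lemma tailn_tailn m n a : (m <= n)%N -> tailn n (tailn m a) = tailn n a.
Proof.
move=> mn; apply/funext => j; rewrite /tailn; case: (ltnP j n) => // nj.
by rewrite ltnNge (leq_trans mn nj).
Qed.

Lemma tailnE n a : tailn n a = a \- headn n a.
Proof.
by apply/funext => j; rewrite /tailn /headn /=; case: ifP; rewrite ?subrr ?subr0.
Qed.

Lemma tailn_headnE m n a : (m <= n)%N -> tailn m (headn n a) = headn n a \- headn m a.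
Proof. by move=> mn; rewrite tailnE headn_headn (minn_idPl mn). Qed.

Lemma headnB n a b : headn n (a \- b) = headn n a \- headn n b.
Proof. by apply/funext => j; rewrite /headn /=; case: ifP; rewrite ?subrr. Qed.

Lemma headnD n a b : headn n (a \+ b) = headn n a \+ headn n b.
Proof. by apply/funext => j; rewrite /headn /=; case: ifP; rewrite ?addr0. Qed.

Lemma tailnD n a b : tailn n (a \+ b) = tailn n a \+ tailn n b.
Proof. by apply/funext => j; rewrite /tailn /=; case: ifP; rewrite ?addr0. Qed.

End sequences_of_scalars.

(** * Bounded multipliers by convexity *)

Section convexity.
Context {R : realType} {E : normedModType R}.

(** The sum is affine in each weight, hence a convex combination of the sums with that weight 0 or
    1. The free base point [v0] lets the induction absorb the head of the list. *)
Lemma norm_weighted_sum_ge0 (vs : seq E) (w : nat -> R) (M : R) v0 :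
  (forall m, `|v0 + \sum_(v <- mask m vs) v| <= M) ->
  (forall k, 0 <= w k <= 1) ->
  `|v0 + \sum_(k < size vs) w k *: vs`_k| <= M.
Proof.
elim: vs v0 w => [|v vs IH] v0 w HM Hw /=.
  by have := HM [::]; rewrite mask0 big_nil big_ord0.
rewrite big_ord_recl/= addrA.
apply: (IH _ (fun k => w k.+1)) => // m.
have H1 := HM (true :: m); have H0 := HM (false :: m).
rewrite /= big_cons in H1; rewrite /= in H0.
set S := \sum_(_ <- _) _ in H0 H1 *.
have -> : v0 + w 0%N *: v + S =
    w 0%N *: (v0 + (v + S)) + (1 - w 0%N) *: (v0 + S).
  rewrite (addrCA v0 v S) scalerDr scalerBl scale1r -[RHS]addrA.
  by rewrite [X in _ = _ + X]addrC subrK addrAC addrC.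
have /andP[w0 w1] := Hw 0%N.
rewrite (le_trans (ler_normD _ _))// !normrZ ger0_norm// ger0_norm ?subr_ge0//.
have -> : M = w 0%N * M + (1 - w 0%N) * M by ring.
by rewrite lerD// ler_wpM2l// subr_ge0.
Qed.

(** The factor 2 comes from splitting [w] into its positive and negative parts. *)
Lemma norm_weighted_sum (vs : seq E) (w : nat -> R) (M : R) :
  (forall m, `|\sum_(v <- mask m vs) v| <= M) ->
  (forall k, `|w k| <= 1) ->
  `|\sum_(k < size vs) w k *: vs`_k| <= 2 * M.
Proof.
move=> HM Hw.
have H (w' : nat -> R) : (forall k, 0 <= w' k <= 1) ->
    `|\sum_(k < size vs) w' k *: vs`_k| <= M.
  move=> w'01; have := @norm_weighted_sum_ge0 vs w' M 0.
  by rewrite add0r; apply => // m; rewrite add0r.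
pose wp k := Num.max (w k) 0; pose wn k := Num.max (- w k) 0.
have -> : \sum_(k < size vs) w k *: vs`_k =
    \sum_(k < size vs) wp k *: vs`_k - \sum_(k < size vs) wn k *: vs`_k.
  rewrite -sumrB; apply: eq_bigr => k _; rewrite -scalerBl; congr (_ *: _).
  by rewrite /wp /wn; have [/=|/=] := leP (w k) 0; have [|] := leP (- w k) 0; lra.
have Hwk k := Hw k; rewrite (le_trans (ler_normB _ _))//.
have -> : 2 * M = M + M by ring.
by apply: lerD; apply: H => k; have := Hw k; rewrite ler_norml /wp /wn => /andP[? ?];
  rewrite le_max lexx orbT ge_max; apply/andP; split => //; lra.
Qed.

End convexity.

(** The 1 keeps the bound positive, so that it can serve as a denominator. *)
Lemma norm_le_1Dsum {R : realType} {E : normedModType R} (e : nat -> E) d p :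
  (p < d)%N -> `|e p| <= 1 + \sum_(q < d) `|e q|.
Proof.
move=> pd; rewrite (bigD1 (Ordinal pd))//=.
have : 0 <= \sum_(q < d | q != Ordinal pd) `|e q| by exact: sumr_ge0.
by lra.
Qed.

(** * The James norm through families of half-open intervals *)

Section admissible.
Context {R : realType} {E : normedModType R} (e : nat -> E).
Implicit Types (a b : nat -> R) (s : seq (nat * nat)).

(** Members are half-open intervals [[I.1, I.2)], possibly empty, so that clipping a member on the
    right keeps a family admissible. *)
Fixpoint admissible (n : nat) s : bool :=
  if s is i :: s' then [&& (n <= i.1)%N, (i.1 <= i.2)%N & admissible i.2 s'] else true.

Lemma admissible_le m n s : (m <= n)%N -> admissible n s -> admissible m s.
Proof. by case: s => //= I s mn /and3P[nI -> ->]; rewrite (leq_trans mn). Qed.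

Lemma admissible_mask n s m : admissible n s -> admissible n (mask m s).
Proof.
elim: s n m => [|I s IH] n [|[] m]//= /and3P[nI II As]; first by rewrite nI II IH.
by apply: IH; apply: admissible_le As; rewrite (leq_trans nI).
Qed.

Lemma admissible_sum_lt n s (j : nat) (x : nat * nat -> R) :
  admissible n s -> (j < n)%N ->
  \sum_(I <- s | (I.1 <= j < I.2)%N) x I = 0.
Proof.
elim: s n => [|I s IH] n /=; first by rewrite big_nil.
move=> /and3P[nI II As] jn; rewrite big_cons leqNgt (leq_trans jn nI)/=.
by apply: IH As _; lia.
Qed.

(** The members are disjoint, so at most one of them contains [j]. *)
Lemma admissible_sum_le n s (j : nat) (x : nat * nat -> R) (B : R) :
  admissible n s -> 0 <= B ->
  (forall I, (I.1 <= j < I.2)%N -> x I <= B) ->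
  \sum_(I <- s | (I.1 <= j < I.2)%N) x I <= B.
Proof.
move=> + B0 xB; elim: s n => [|I s IH] n /=; first by rewrite big_nil.
move=> /and3P[nI II As]; rewrite big_cons; case: ifPn => jI; last exact: IH As.
by rewrite (admissible_sum_lt _ As) ?addr0 ?xB//; case/andP: jI.
Qed.

Definition james_sum a s : E := \sum_(I <- s) isum a I.1 I.2 *: e I.1.

(** The norm is handled through its upper bounds, which make sense for sequences of infinite support
    and avoid extended reals; [james_norm_leP] is the link with [james_norm]. *)
Definition james_le a (M : R) := forall s, admissible 0 s -> `|james_sum a s| <= M.

Lemma james_le_ge0 a M : james_le a M -> 0 <= M.
Proof. by move=> /(_ [::] isT); apply: le_trans. Qed.

Lemma james_leW a M N : M <= N -> james_le a M -> james_le a N.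
Proof. by move=> MN aM s /aM/le_trans; apply. Qed.

Lemma james_leD a b M N : james_le a M -> james_le b N -> james_le (a \+ b) (M + N).
Proof.
move=> aM bN s As.
have -> : james_sum (a \+ b) s = james_sum a s + james_sum b s.
  by rewrite /james_sum -big_split/=; apply: eq_bigr => I _; rewrite isumD scalerDl.
by rewrite (le_trans (ler_normD _ _))// lerD ?aM ?bN.
Qed.

Lemma james_leZ (k : R) a M : james_le a M -> james_le (k \o* a) (`|k| * M).
Proof.
move=> aM s As.
have -> : james_sum (k \o* a) s = k *: james_sum a s.
  by rewrite /james_sum scaler_sumr; apply: eq_bigr => I _; rewrite isumZ scalerA.
by rewrite normrZ ler_wpM2l ?aM.
Qed.

Lemma james_leB a b M N : james_le a M -> james_le b N -> james_le (a \- b) (M + N).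
Proof.
move=> aM bN s As.
have -> : james_sum (a \- b) s = james_sum a s - james_sum b s.
  by rewrite /james_sum -sumrB/=; apply: eq_bigr => I _; rewrite isumB scalerBl.
by rewrite (le_trans (ler_normB _ _))// lerD ?aM ?bN.
Qed.

Lemma james_le0 : james_le (fun=> 0) 0.
Proof.
move=> s _; rewrite /james_sum big1 ?normr0// => I _.
by rewrite /isum big1// scale0r.
Qed.

Lemma james_le_sum (K : nat) (a : nat -> nat -> R) (M : nat -> R) :
  (forall k, (k < K)%N -> james_le (a k) (M k)) ->
  james_le (fun j => \sum_(k < K) a k j) (\sum_(k < K) M k).
Proof.
elim: K => [_|K IH aM].
  rewrite big_ord0 (_ : (fun _ => _) = fun=> 0); first exact: james_le0.
  by apply/funext => j; rewrite big_ord0.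
rewrite big_ord_recr/=.
have -> : (fun j => \sum_(k < K.+1) a k j) = (fun j => \sum_(k < K) a k j) \+ a K.
  by apply/funext => j; rewrite big_ord_recr.
by apply: james_leD; [apply: IH => k kK; apply: aM; lia|exact: aM].
Qed.

(* Discarding members of an admissible family leaves an admissible family, so
   the James norm controls all partial sums and hence, by convexity, all
   multipliers: this is why no unconditional constant of (e_i) is needed. *)
Lemma james_le_weighted a M s (w : nat * nat -> R) (g : nat * nat -> nat) :
  james_le a M -> admissible 0 s -> (forall I, (g I <= I.2)%N) ->
  (forall I, `|w I| <= 1) ->
  `|\sum_(I <- s) (w I * isum a I.1 (g I)) *: e I.1| <= 2 * M.
Proof.
move=> aM As gI wI.
pose h I := (I.1, maxn I.1 (g I)) : nat * nat.
have hsum I : isum a I.1 (g I) = isum a (h I).1 (h I).2.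
  rewrite /h/=; have [Ig|/ltnW gI'] := leqP I.1 (g I) => //.
  by rewrite !isum_geq.
have admh n s' : admissible n s' -> admissible n (map h s').
  elim: s' n => //= I s' IH n /and3P[nI II As']; rewrite nI leq_maxl/=.
  by apply: IH; apply: admissible_le As'; rewrite geq_max II gI.
pose vs := [seq isum a i.1 (g i) *: e i.1 | i <- s].
have vsM m : `|\sum_(v <- mask m vs) v| <= M.
  rewrite -map_mask big_map.
  rewrite (eq_bigr (fun I => isum a (h I).1 (h I).2 *: e (h I).1)); last first.
    by move=> I _; rewrite hsum.
  rewrite -(big_map h xpredT (fun I => isum a I.1 I.2 *: e I.1)).
  by apply: aM; apply: admh; exact: admissible_mask.
have := @norm_weighted_sum R E vs (fun k => w (nth (0%N, 0%N) s k)) M vsM (fun=> wI _).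
rewrite /vs size_map (big_nth (0%N, 0%N)) big_mkord.
under [X in `|X| <= _ -> _]eq_bigr => i _.
  rewrite (nth_map (0%N, 0%N)) ?ltn_ord// scalerA.
  over.
by [].
Qed.

(** Clipping the intervals at [n] moves only right ends, so the vectors [e I.1] stay the same. *)
Lemma james_le_headn n a M : james_le a M -> james_le (headn n a) M.
Proof.
move=> aM s As.
pose h I := (I.1, maxn I.1 (minn I.2 n)) : nat * nat.
have -> : james_sum (headn n a) s = james_sum a (map h s).
  rewrite /james_sum big_map; apply: eq_bigr => I _; rewrite isum_headn/=.
  have [Ig|/ltnW gI'] := leqP I.1 (minn I.2 n) => //.
  by rewrite !isum_geq.
apply: aM; elim: s 0%N As => //= I s' IH m /and3P[nI II As']; rewrite nI leq_maxl/=.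
by apply: IH; apply: admissible_le As'; lia.
Qed.

(** Clipping on the left would change the vectors [e I.1]; the tail is therefore treated as a
    difference, which costs a factor 2. *)
Lemma james_le_tailn n a M : james_le a M -> james_le (tailn n a) (2 * M).
Proof.
by move=> aM; rewrite tailnE mulr_natl mulr2n; apply: james_leB => //; exact: james_le_headn.
Qed.

Lemma james_le_isum a M p q : james_le a M -> `|isum a p q| * `|e p| <= M.
Proof.
move=> aM; have [pq|/ltnW qp] := leqP p q; last first.
  by rewrite isum_geq// normr0 mul0r (james_le_ge0 aM).
have := aM [:: (p, q)]; rewrite /= pq => /(_ isT).
by rewrite /james_sum big_seq1/= normrZ.
Qed.

(** Each [j < N] lies in at most one interval, which then starts below [N]. This crude bound turns
    coordinatewise convergence into norm convergence of finite heads. *)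
Lemma james_le_headn_coord N a (t : R) :
  0 <= t -> (forall j, (j < N)%N -> `|a j| <= t) ->
  james_le (headn N a) (t * (N%:R * \sum_(p < N) `|e p|)).
Proof.
move=> t0 at_ s As.
set B := \sum_(p < N) `|e p|.
have eB p : (p < N)%N -> `|e p| <= B.
  move=> pN; rewrite /B (bigD1 (Ordinal pN))//= lerDl.
  by apply: sumr_ge0 => *; exact: normr_ge0.
have B0 : 0 <= B by apply: sumr_ge0 => *; exact: normr_ge0.
have isumE I : isum (headn N a) I.1 I.2 =
    \sum_(j < N | (I.1 <= j < I.2)%N) a j.
  rewrite isum_headn /isum.
  rewrite (big_nat_widenl _ 0)//= (big_nat_widen _ _ N) ?geq_minr// big_mkord.
  apply: eq_bigl => j; rewrite leq_min ltn_ord andbT.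
  by [].
rewrite (le_trans (ler_norm_sum _ _ _))//.
have H I : `|isum (headn N a) I.1 I.2 *: e I.1| <=
    \sum_(j < N | (I.1 <= j < I.2)%N) t * `|e I.1|.
  rewrite normrZ isumE -mulr_suml ler_wpM2r// (le_trans (ler_norm_sum _ _ _))//.
  by apply: ler_sum => j _; exact: at_.
apply: (le_trans (ler_sum _ (fun I _ => H I))).
rewrite (exchange_big_dep xpredT)//=.
have -> : t * (N%:R * B) = \sum_(j < N) t * B.
  by rewrite sumr_const card_ord -mulrnAr mulr_natl.
apply: ler_sum => j _; apply: (admissible_sum_le As); first exact: mulr_ge0.
by move=> I /andP[Ij _]; rewrite ler_wpM2l// eB// (leq_ltn_trans Ij).
Qed.

End admissible.

(** * Cutting a sequence into successive zones *)

Lemma zones_ordered (c d : nat -> nat) :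
  (forall k, c k < d k)%N -> (forall k, d k <= c k.+1)%N ->
  [/\ {homo c : k l / (k <= l)%N}, {homo d : k l / (k <= l)%N} &
      forall k l, (k < l)%N -> (d k <= c l)%N].
Proof.
move=> cd dc.
have cc : {homo c : k l / (k <= l)%N}.
  apply: homo_leq => //= [y x z|k]; first exact: leq_trans.
  by rewrite (leq_trans _ (dc k))// ltnW.
split=> // [|k l kl]; last by rewrite (leq_trans (dc k))// cc.
apply: homo_leq => //= [y x z|k]; first exact: leq_trans.
by rewrite (leq_trans (dc k))// ltnW.
Qed.

Section zones.
Context {R : realType} {E : normedModType R} (e : nat -> E).

Lemma find_iotaP (P : pred nat) K : let f := find P (iota 0 K) in
  [/\ forall k, (k < f)%N -> ~~ P k, (f < K)%N -> P f & (f <= K)%N].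
Proof.
have fK : (find P (iota 0 K) <= K)%N by rewrite -{2}(size_iota 0 K) find_size.
split=> // [k kf|flt].
  have := before_find 0%N kf; rewrite nth_iota ?add0n ?(leq_trans kf)// => ->.
  by [].
have : has P (iota 0 K) by rewrite has_find size_iota.
by move=> /(nth_find 0%N); rewrite nth_iota.
Qed.

(* Each interval [p, q) meets the zones [c k, d k) in a first zone, a last zone
   and complete zones in between. The first and last contributions are
   differences of sums over intervals that also start at p, hence controlled
   by the James norm of a; the complete zones are controlled by their total
   masses. *)
Lemma james_le_zones (a : nat -> R) (M : R) (c d : nat -> nat) (w eps : nat -> R) K :
  james_le e a M -> (forall k, (c k < d k)%N) -> (forall k, (d k <= c k.+1)%N) ->
  (forall k, `|w k| <= 1) -> (forall k, 0 <= eps k) ->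
  (forall k p, (k.+1 < K)%N -> (p < d k)%N ->
    `|isum a (c k.+1) (d k.+1)| * `|e p| <= eps k.+1) ->
  james_le e (fun j => \sum_(k < K) w k * tailn (c k) (headn (d k) a) j)
    (8 * M + \sum_(k < K) eps k).
Proof.
move=> aM cd dc w1 eps0 aeps s As; set b := fun j => _.
have [cc dd dc'] := zones_ordered cd dc.
(* Only zones with [i0 I <= k < i1 I] can meet [I]; both indices default to [K] when the search
   fails. *)
pose i0 (I : nat * nat) := find (fun k => (I.1 < d k)%N) (iota 0 K).
pose i1 (I : nat * nat) := find (fun k => (I.2 <= c k)%N) (iota 0 K).
pose D (I : nat * nat) k := isum a I.1 (minn I.2 (d k)) - isum a I.1 (minn I.2 (c k)).
pose mid I k := (i0 I < k)%N && (k.+1 < i1 I)%N.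
have isumb I : isum b I.1 I.2 = \sum_(k < K) w k * D I k.
  rewrite /isum /b exchange_big/=; apply: eq_bigr => k _.
  rewrite -mulr_sumr; congr (_ * _).
  by rewrite -/(isum _ _ _) (tailn_headnE _ (ltnW (cd k))) isumB !isum_headn.
have midP I k : mid I k -> (k < K)%N ->
    [/\ (I.1 < d k.-1)%N, (0 < k)%N, (I.1 <= c k)%N & (d k < I.2)%N].
  move=> /andP[ik ki] kK.
  have [_ + _] := find_iotaP (fun k => (I.1 < d k)%N) K.
  rewrite -/(i0 I) => /(_ (ltn_trans ik kK)) Id.
  have [+ _ _] := find_iotaP (fun k => (I.2 <= c k)%N) K.
  rewrite -/(i1 I) => /(_ _ ki); rewrite -ltnNge => cI.
  have k0 : (0 < k)%N by exact: leq_ltn_trans ik.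
  have Idk : (I.1 < d k.-1)%N by rewrite (leq_trans Id)// dd// -ltnS prednK.
  split => //; last by rewrite (leq_ltn_trans _ cI).
  by rewrite (leq_trans (ltnW Idk))// dc'// prednK.
(* The condition [i0 I < (i1 I).-1] keeps a single zone from being counted both as first and as
   last. *)
have Dcase I k : (k < K)%N -> w k * D I k =
    (if (k == i0 I) && (i0 I < i1 I)%N then w k * D I k else 0) +
    (if (k == (i1 I).-1) && (i0 I < (i1 I).-1)%N then w k * D I k else 0) +
    (if mid I k then w k * isum a (c k) (d k) else 0).
  move=> kK.
  have [H0 H1 H2] := find_iotaP (fun k => (I.1 < d k)%N) K.
  have [G0 G1 G2] := find_iotaP (fun k => (I.2 <= c k)%N) K.
  rewrite -/(i0 I) -/(i1 I) in H0 H1 H2 G0 G1 G2.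
  have [ki|ik] := ltnP k (i0 I).
    have -> : (k == i0 I) = false by lia.
    have -> : (k == (i1 I).-1) && (i0 I < (i1 I).-1)%N = false by lia.
    have -> : mid I k = false by rewrite /mid; lia.
    rewrite /= !addr0.
    have := H0 _ ki; rewrite -leqNgt => dI.
    by rewrite /D !isum_geq ?subr0 ?mulr0// geq_min ?dI ?(leq_trans (ltnW (cd k)) dI) orbT.
  have [ki|ik'] := leqP (i1 I) k.
    have -> : (k == i0 I) && (i0 I < i1 I)%N = false by lia.
    have -> : (k == (i1 I).-1) && (i0 I < (i1 I).-1)%N = false by lia.
    have -> : mid I k = false by rewrite /mid; lia.
    rewrite !addr0 /D.
    have Ic : (I.2 <= c k)%N by rewrite (leq_trans (G1 _))// ?cc// (leq_ltn_trans ki).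
    by rewrite (minn_idPl Ic) (minn_idPl (leq_trans Ic (ltnW (cd k)))) subrr mulr0.
  have [ki0|ki0] := eqVneq k (i0 I).
    have -> : (i0 I < i1 I)%N by rewrite -ki0.
    have -> : (k == (i1 I).-1) && (i0 I < (i1 I).-1)%N = false by lia.
    have -> : mid I k = false by rewrite /mid; lia.
    by rewrite !addr0.
  have [ki1|ki1] := eqVneq k (i1 I).-1.
    have -> : (i0 I < (i1 I).-1)%N by lia.
    have -> : mid I k = false by rewrite /mid; lia.
    by rewrite /= addr0 add0r.
  have m : mid I k by rewrite /mid; lia.
  rewrite m /= !add0r; congr (_ * _).
  have [_ _ Ic dI] := midP _ _ m kK.
  rewrite /D (minn_idPr (ltnW dI)) (minn_idPr (ltnW (ltn_trans (cd k) dI))).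
  by rewrite (isum_cat a Ic (ltnW (cd k))) addrC addKr.
pose wa I := if (i0 I < i1 I)%N then w (i0 I) else 0.
pose wb I := if (i0 I < (i1 I).-1)%N then w (i1 I).-1 else 0.
have sumk I (j : nat) (b0 : bool) : (b0 -> (j < K)%N) ->
    \sum_(k < K) (if (nat_of_ord k == j) && b0 then w k * D I k else 0) =
    (if b0 then w j else 0) * D I j.
  case: b0 => [/(_ isT) jK|_]; last first.
    by rewrite mul0r big1// => k _; rewrite andbF.
  rewrite (bigD1 (Ordinal jK))//= eqxx/= big1 ?addr0// => k.
  by rewrite -val_eqE/= andbT => /negbTE ->.
have isumb' I : isum b I.1 I.2 =
    wa I * isum a I.1 (minn I.2 (d (i0 I))) - wa I * isum a I.1 (minn I.2 (c (i0 I)))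
    + (wb I * isum a I.1 (minn I.2 (d (i1 I).-1))
      - wb I * isum a I.1 (minn I.2 (c (i1 I).-1)))
    + \sum_(k < K | mid I k) w k * isum a (c k) (d k).
  rewrite isumb; etransitivity.
    by apply: eq_bigr => k _; exact: (Dcase I _ (ltn_ord k)).
  rewrite !big_split/=.
  have [_ _ i1K] := find_iotaP (fun k => (I.2 <= c k)%N) K; rewrite -/(i1 I) in i1K.
  rewrite sumk; last by move=> h; exact: leq_trans i1K.
  rewrite sumk; last by move=> h; lia.
  by rewrite -!mulrBr -big_mkcond.
rewrite /james_sum.
pose S (w' : nat * nat -> R) (g : nat * nat -> nat) :=
  \sum_(I <- s) (w' I * isum a I.1 (g I)) *: e I.1.
have wa1 I : `|wa I| <= 1 by rewrite /wa; case: ifP => _; rewrite ?normr0 ?ler01.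
have wb1 I : `|wb I| <= 1 by rewrite /wb; case: ifP => _; rewrite ?normr0 ?ler01.
have -> : \sum_(I <- s) isum b I.1 I.2 *: e I.1 =
    S wa (fun I => minn I.2 (d (i0 I))) - S wa (fun I => minn I.2 (c (i0 I)))
    + (S wb (fun I => minn I.2 (d (i1 I).-1)) - S wb (fun I => minn I.2 (c (i1 I).-1)))
    + \sum_(I <- s) (\sum_(k < K | mid I k) w k * isum a (c k) (d k)) *: e I.1.
  rewrite /S -!sumrB -!big_split/=; apply: eq_bigr => I _.
  by rewrite isumb' scalerDl scalerDl !scalerBl.
have Sle w' g : (forall I, `|w' I| <= 1) -> (forall I, (g I <= I.2)%N) ->
    `|S w' g| <= 2 * M.
  by move=> w'1 gI; apply: james_le_weighted aM As gI w'1.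
(* A complete zone has its left end in [I], which happens for at most one [I] of the family; and [I]
   starts before the end of the preceding zone, which is the range of [p] in the hypothesis on
   [eps]. *)
have midle : `|\sum_(I <- s) (\sum_(k < K | mid I k) w k * isum a (c k) (d k)) *: e I.1|
    <= \sum_(k < K) eps k.
  rewrite (le_trans (ler_norm_sum _ _ _))//.
  apply: (@le_trans _ _ (\sum_(I <- s) \sum_(k < K | (I.1 <= c k < I.2)%N) eps k)).
    apply: ler_sum => I _; rewrite normrZ.
    apply: (@le_trans _ _ (\sum_(k < K | mid I k) eps k)).
      apply: (le_trans (ler_wpM2r _ (ler_norm_sum _ _ _))) => //.
      rewrite mulr_suml; apply: ler_sum => k mk.
      have [Idk k0 _ _] := midP _ _ mk (ltn_ord k).
      have := aeps k.-1 I.1; rewrite prednK// => /(_ (ltn_ord k) Idk).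
      apply: le_trans; rewrite ler_wpM2r// normrM.
      by rewrite ler_piMl.
    rewrite big_mkcond [leRHS]big_mkcond/=; apply: ler_sum => k _.
    case: ifPn => [mk|_]; last by case: ifP.
    have [_ _ -> dI] := midP _ _ mk (ltn_ord k).
    by rewrite /= (ltn_trans (cd k) dI).
  rewrite (exchange_big_dep xpredT)//=; apply: ler_sum => k _.
  exact: (admissible_sum_le As).
have -> : 8 * M = 2 * M + 2 * M + (2 * M + 2 * M) by ring.
do 2 rewrite (le_trans (ler_normD _ _))// lerD//.
  by rewrite (le_trans (ler_normB _ _))// lerD// Sle// => I; rewrite geq_minl.
by rewrite (le_trans (ler_normB _ _))// lerD// Sle// => I; rewrite geq_minl.
Qed.

End zones.

(** * Comparison with [james_norm] *)

Section james_norm_bound.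
Context {R : realType} {E : normedModType R} (e : nat -> E).

(** A closed block from [p] to [q] becomes [[p, q.+1)]. Conversely, empty intervals have no closed
    counterpart, but they contribute 0 and are dropped. *)
Lemma james_norm_leP (a : nat -> R) (M : R) :
  james_le e a M <-> (james_norm e a <= M%:E)%E.
Proof.
split => [aM|aM s As].
  apply: ge_ereal_sup => _ [k [p [q [pq qp ->]]]]; rewrite lee_fin.
  pose s := [seq (p i, (q i).+1) | i <- iota 0 k].
  have -> : \sum_(i < k) (\sum_(p i <= j < (q i).+1) a j) *: e (p i) = james_sum e a s.
    rewrite /james_sum big_map -[X in iota 0 X]subn0 -/(index_iota 0 k) big_mkord.
    by [].
  apply: aM; rewrite {}/s.
  have H m i n : (i + m <= k)%N -> (0 < m -> n <= p i)%N ->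
      admissible n [seq (p i, (q i).+1) | i <- iota i m].
    elim: m i n => //= m IH i n imk ->//=.
    rewrite (leq_trans (pq i _)) ?ltnS//=; last by lia.
    by apply: IH => [|m0]; [lia|apply: qp; lia].
  exact: H.
pose s' := [seq i <- s | (i.1 < i.2)%N].
have -> : james_sum e a s = james_sum e a s'.
  rewrite /james_sum big_filter [RHS]big_mkcond/=; apply: eq_bigr => I _.
  by case: ltnP => // ?; rewrite isum_geq ?scale0r.
have As' : admissible 0 s' by rewrite /s' filter_mask; exact: admissible_mask.
have ne i : (i < size s')%N -> ((nth (0%N,0%N) s' i).1 < (nth (0%N,0%N) s' i).2)%N.
  by move=> /(mem_nth (0%N,0%N)); rewrite mem_filter => /andP[].
rewrite -lee_fin (le_trans _ aM)//; apply: ereal_sup_ubound.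
exists (size s'), (fun i => (nth (0%N,0%N) s' i).1), (fun i => (nth (0%N,0%N) s' i).2.-1).
split=> [i /ne|i|]; first by lia.
- move=> i1; have := ne _ (ltnW i1).
  suff H t n k : (k.+1 < size t)%N -> admissible n t ->
      ((nth (0%N,0%N) t k).2 <= (nth (0%N,0%N) t k.+1).1)%N.
    by have := H _ _ _ i1 As'; lia.
  elim: t n k => //= I t IH n [|k] k1 /and3P[_ _ At].
    by case: t k1 At {IH} => //= J t _ /and3P[].
  exact: (IH _ _ k1 At).
- congr ((`|_|)%:E); rewrite /james_sum (big_nth (0%N,0%N)) big_mkord.
  by apply: eq_bigr => i _; rewrite prednK ?(leq_ltn_trans _ (ne i _)).
Qed.

End james_norm_bound.

(** * Limits along an ultrafilter *)

Section ultralimits.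
Context {R : realType} (U : set_system nat) {UU : UltraFilter U}.
Implicit Types g h : nat -> R.

Definition ulim g : R := lim (g @ U).

(** Compactness of the segment gives a cluster point, and a cluster point of an ultrafilter is a
    limit. *)
Lemma ulim_cvg g (M : R) : (forall n, `|g n| <= M) -> g @ U --> ulim g.
Proof.
move=> gM.
have gU : (g @ U) [set` `[- M, M]].
  by apply: (@filterE _ U) => n /=; rewrite in_itv/= -ler_norml.
have [x [_ gx]] := @segment_compact R (- M) M (g @ U) _ gU.
suff gUx : g @ U --> x by rewrite /ulim (cvg_lim _ gUx).
move=> A Ax; have [//|UnA] := in_ultra_setVsetC (g @^-1` A) UU.
by have [y [nAy Ay]] := gx (~` A) A UnA Ax.
Qed.

Lemma ulim_eq g x : g @ U --> x -> ulim g = x.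
Proof. by move=> gx; rewrite /ulim (cvg_lim _ gx). Qed.

Lemma ulim_norm_le g (M : R) : (forall n, `|g n| <= M) -> `|ulim g| <= M.
Proof.
move=> gM; have /cvg_norm gl := ulim_cvg gM.
by apply: (cvgr_to_le gl); exact: filterE.
Qed.

Lemma near_all_lt (P : nat -> nat -> Prop) c :
  (forall j, \forall n \near U, P j n) ->
  \forall n \near U, forall j, (j < c)%N -> P j n.
Proof.
move=> PU; elim: c => [|c IH]; first by apply: filterE => n j; rewrite ltn0.
apply: filterS2 IH (PU c) => n H Pc j; rewrite ltnS leq_eqVlt => /predU1P[->//|].
exact: H.
Qed.

Lemma cvg_sumr (V : normedModType R) (I : Type) (r : seq I) (f : nat -> I -> V)
    (l : I -> V) : (forall i, f n i @[n --> U] --> l i) ->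
  \sum_(i <- r) f n i @[n --> U] --> \sum_(i <- r) l i.
Proof.
move=> fl; elim: r => [|i r IH].
  rewrite big_nil (_ : (fun n => _) = fun=> 0); first exact: cvg_cst.
  by apply/funext => n; rewrite big_nil.
rewrite big_cons (_ : (fun n => _) = fun n => f n i + \sum_(i <- r) f n i).
  exact: cvgD.
by apply/funext => n; rewrite big_cons.
Qed.

End ultralimits.

(** * James bounds and total mass along an ultrafilter *)

Section james_ultralimits.
Context {R : realType} {E : normedModType R} (e : nat -> E).
Context (U : set_system nat) {UU : UltraFilter U} (Uoo : \oo `<=` U).
Implicit Types a b : nat -> R.

Lemma cvg_isum (a_ : nat -> nat -> R) a p q :
  (forall j, a_ n j @[n --> U] --> a j) ->
  isum (a_ n) p q @[n --> U] --> isum a p q.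
Proof.
move=> aa; rewrite /isum; apply: cvg_sumr => j; exact: aa.
Qed.

(** Each James sum involves finitely many coordinates, so its bound survives coordinatewise
    limits. *)
Lemma james_le_ulim (a_ : nat -> nat -> R) a M :
  (forall n, james_le e (a_ n) M) -> (forall j, a_ n j @[n --> U] --> a j) ->
  james_le e a M.
Proof.
move=> aM aa s As.
have H : james_sum e (a_ n) s @[n --> U] --> james_sum e a s.
  rewrite /james_sum; apply: cvg_sumr => I.
  by apply: cvgZr_tmp; exact: cvg_isum.
have /cvg_norm Hn := H.
by apply: (cvgr_to_le Hn); apply: filterE => n; exact: aM.
Qed.

(** The total mass of [a]. Partial sums of a sequence of finite James norm are bounded (if
    [e 0 != 0]) but need not converge. *)
Definition ulimsum a : R := ulim U (fun n => isum a 0 n).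

Hypothesis e0 : e 0 != 0.

Let v0 := `|e 0|.
Let v0_gt0 : 0 < v0. Proof. by rewrite normr_gt0. Qed.

Lemma isum_norm_le a M q : james_le e a M -> `|isum a 0 q| <= M / v0.
Proof. by move=> aM; rewrite ler_pdivlMr//; exact: james_le_isum. Qed.

Lemma ulimsum_cvg a M : james_le e a M -> isum a 0 n @[n --> U] --> ulimsum a.
Proof. by move=> aM; apply: (@ulim_cvg _ _ _ _ (M / v0)) => n; exact: isum_norm_le. Qed.

Lemma ulimsum_norm_le a M : james_le e a M -> `|ulimsum a| <= M / v0.
Proof. by move=> aM; apply: ulim_norm_le => n; exact: isum_norm_le. Qed.

Lemma ulimsumB a b M N : james_le e a M -> james_le e b N ->
  ulimsum (a \- b) = ulimsum a - ulimsum b.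
Proof.
move=> aM bN; apply: ulim_eq.
rewrite (_ : (fun n => isum (a \- b) 0 n) = (fun n => isum a 0 n - isum b 0 n)).
  by apply: cvgB; [exact: ulimsum_cvg aM|exact: ulimsum_cvg bN].
by apply/funext => n; rewrite isumB.
Qed.

Lemma ulimsum_sub_isum a M p (x : R) :
  james_le e a M -> (forall q, (p <= q)%N -> `|isum a p q| <= x) ->
  `|ulimsum a - isum a 0 p| <= x.
Proof.
move=> aM ax.
have H : `|isum a 0 n - isum a 0 p| @[n --> U] --> `|ulimsum a - isum a 0 p|.
  apply: cvg_norm; apply: cvgB; [exact: ulimsum_cvg aM|exact: cvg_cst].
apply: (cvgr_to_le H); apply: (filterS _ (Uoo (nbhs_infty_ge p))) => n /= pn.
by rewrite (isum_cat a (leq0n p) pn) addrC addKr ax.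
Qed.

Lemma isum_tailn a p q : (p <= q)%N -> isum (tailn p a) 0 q = isum a p q.
Proof.
move=> pq; rewrite tailnE isumB isum_headn (minn_idPr pq).
by rewrite (isum_cat a (leq0n p) pq) addrC addKr.
Qed.

Lemma ulimsum_tailn a M p (x : R) : james_le e a M -> james_le e (tailn p a) x ->
  `|ulimsum a - isum a 0 p| * v0 <= x.
Proof.
move=> aM ax; rewrite -ler_pdivlMr//.
apply: ulimsum_sub_isum aM _ => q pq; rewrite -isum_tailn//.
exact: isum_norm_le.
Qed.

(** The mass beyond [p] is a limit of sums over intervals starting at [p], so it is small when [e p]
    is large. *)
Lemma ulimsum_norm a M p : james_le e a M -> `|ulimsum a - isum a 0 p| * `|e p| <= M.
Proof.
move=> aM; have [->|ep] := eqVneq (e p) 0.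
  by rewrite normr0 mulr0 (james_le_ge0 aM).
rewrite -ler_pdivlMr ?normr_gt0//; apply: (ulimsum_sub_isum aM) => q pq.
by rewrite ler_pdivlMr ?normr_gt0//; exact: james_le_isum.
Qed.

End james_ultralimits.

(** * Two sequences with interlaced steps *)

Section zone_estimate.
Context {R : realType} {E : normedModType R} (e : nat -> E).
Context (U : set_system nat) {UU : UltraFilter U} (Uoo : \oo `<=` U).
Hypothesis e0 : e 0%N != 0.
(** Up to small errors the step from [X k] to [X k.+1] lives on [[c k, d k.+1)] and that from [Y k]
    to [Y k.+1] on [[d k.+1, c k.+1)]. The error [h k] withstands multiplication by [|e p|] for
    [p < d k], and by [G_step] the steps of [X] carry almost no mass. *)
Context (X Y : nat -> nat -> R) (c d : nat -> nat) (h : nat -> R) (eps M : R).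
Let G k := ulimsum U (X k).
Hypothesis XM : forall k, james_le e (X k) M.
Hypothesis d0 : d 0%N = 0%N.
Hypothesis dc : forall k, (d k < c k)%N.
Hypothesis cd : forall k, (c k < d k.+1)%N.
Hypothesis eps0 : 0 <= eps.
Hypothesis h0 : forall k, 0 <= h k.
Hypothesis hS : forall k, h k.+1 <= h k.
Hypothesis he : forall k, h k <= eps.
Hypothesis hep : forall k p, (p < d k)%N -> `|e p| * h k <= eps.
Hypothesis X_tail : forall k, james_le e (tailn (d k) (X k)) eps.
Hypothesis X_tail_c : forall k, james_le e (tailn (c k) (X k)) (h k).
Hypothesis Y_tail_c : forall k, james_le e (tailn (c k) (Y k)) (h k).
Hypothesis X_step : forall k, james_le e (headn (c k) (X k.+1 \- X k)) (h k).
Hypothesis Y_step : forall k, james_le e (headn (d k.+1) (Y k.+1 \- Y k)) (h k).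
Hypothesis X_tail_d : forall k, james_le e (tailn (d k.+1) (X k.+1)) (h k).
Hypothesis G_step : forall k p, (p < d k)%N -> `|G k.+1 - G k| * `|e p| <= eps.

Let h_homo k l : (k <= l)%N -> h l <= h k.
Proof.
elim: l => [|l IH]; first by rewrite leqn0 => /eqP ->.
rewrite leq_eqVlt => /predU1P[->//|]; rewrite ltnS => /IH; exact: le_trans.
Qed.

Let zones := zones_ordered cd (fun k => ltnW (dc k.+1)).

Let c_homo k l : (k <= l)%N -> (c k <= c l)%N.
Proof. by have [cc _ _] := zones; exact: cc. Qed.

Let d_homo k l : (k <= l)%N -> (d k.+1 <= d l.+1)%N.
Proof. by have [_ dd _] := zones; exact: dd. Qed.

(** Telescoping: as [n] increases and [h] decreases, each later step changes the head below [n k] by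
    at most [h k]. *)
Let chain (Z : nat -> nat -> R) (n : nat -> nat) :
  (forall k l, (k <= l)%N -> (n k <= n l)%N) ->
  (forall k, james_le e (headn (n k) (Z k.+1 \- Z k)) (h k)) ->
  forall r k, (k <= r)%N -> james_le e (headn (n k) (Z r \- Z k)) (r%:R * h k).
Proof.
move=> n_homo Zstep r k kr; rewrite -(subnKC kr).
apply: (@james_leW _ _ _ _ ((r - k)%N%:R * h k)).
  by rewrite ler_wpM2r// ler_nat; lia.
elim: (r - k)%N => [|m IH].
  rewrite mul0r addn0 (_ : headn _ _ = fun=> 0); first exact: james_le0.
  by apply/funext => j; rewrite /headn /= subrr; case: ifP.
rewrite addnS (_ : Z _ \- Z k = (Z (k + m).+1 \- Z (k + m)%N) \+ (Z (k + m)%N \- Z k)).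
  rewrite headnD -natr1 mulrDl mul1r addrC; apply: james_leD IH.
  apply: (@james_leW _ _ _ _ (h (k + m)%N)); first by rewrite h_homo// leq_addr.
  by rewrite -(minn_idPl (n_homo _ _ (leq_addr m k))) -headn_headn; exact: james_le_headn.
by apply/funext => j /=; rewrite addrA subrK.
Qed.

Let v0 := `|e 0%N|.
Let v0_gt0 : 0 < v0. Proof. by rewrite normr_gt0. Qed.

Let split_near (Z Z' : nat -> R) m n x y : (m <= n)%N ->
  james_le e (headn n (Z \- Z')) x -> james_le e (tailn m Z') y ->
  james_le e (tailn m (headn n Z)) (y + 2 * x).
Proof.
move=> mn Zx Zy.
rewrite (_ : Z = Z' \+ (Z \- Z')); last by apply/funext => j /=; rewrite addrC subrK.
rewrite headnD tailnD; apply: james_leD; first by rewrite tailn_headn; exact: james_le_headn.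
exact: james_le_tailn.
Qed.

Let isum_headn0 (Z : nat -> R) n x : james_le e (headn n Z) x -> `|isum Z 0 n| * v0 <= x.
Proof. by move=> /(james_le_isum 0 n); rewrite isum_headn minnn. Qed.

(** [X r] is close to [X k.+1] below [d k.+1] and to [X k] below [c k], and these have small tails
    there; so its sum over the zone is close to [G k.+1 - G k], while [Y r] is small on the zone.
    The constant collects [r + 1 + 1 + r] errors [h k] from [X] and [1 + 2 * r] from [Y]; the final
    1 stands for the step of [G]. *)
Let mass r k p : (k < r)%N -> (p < d k)%N ->
  `|isum (X r \- Y r) (c k) (d k.+1)| * `|e p|
    <= eps * ((4 * r%:R + 3) / v0 + 1).
Proof.
move=> kr pd.
have chX := chain c_homo X_step; have chY := chain d_homo Y_step.
have Y1 : `|isum (Y r) (c k) (d k.+1)| * v0 <= h k + 2 * (r%:R * h k).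
  have := split_near (ltnW (cd k)) (chY _ _ (ltnW kr)) (Y_tail_c k).
  move=> /(james_le_isum 0 (d k.+1)).
  by rewrite (isum_tailn _ (ltnW (cd k))) isum_headn minnn.
have X1 : `|isum (X r) 0 (d k.+1) - isum (X k.+1) 0 (d k.+1)| * v0 <= r%:R * h k.
  rewrite -isumB; apply: isum_headn0.
  rewrite -(minn_idPl (ltnW (dc k.+1))) -headn_headn; apply: james_le_headn.
  apply: james_leW (chX _ _ kr); by rewrite ler_wpM2l// ler0n.
have X2 : `|G k.+1 - isum (X k.+1) 0 (d k.+1)| * v0 <= h k.
  exact: ulimsum_tailn (XM _) (X_tail_d k).
have X3 : `|G k - isum (X k) 0 (c k)| * v0 <= h k.
  exact: ulimsum_tailn (XM _) (X_tail_c k).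
have X4 : `|isum (X r) 0 (c k) - isum (X k) 0 (c k)| * v0 <= r%:R * h k.
  by rewrite -isumB; apply: isum_headn0; exact: chX (ltnW kr).
have Gk := G_step pd.
rewrite isumB.
have -> : isum (X r) (c k) (d k.+1) = isum (X r) 0 (d k.+1) - isum (X r) 0 (c k).
  by rewrite (isum_cat (X r) (leq0n (c k)) (ltnW (cd k))) addrC addKr.
move: Y1 X1 X2 X3 X4 Gk.
move: (isum (Y r) _ _) (isum (X r) 0 (d k.+1)) (isum (X k.+1) _ _)
  (isum (X r) 0 (c k)) (isum (X k) _ _) (G k.+1) (G k) => y x1 x2 x3 x4 g1 g.
rewrite -!(ler_pdivlMr _ _ v0_gt0) => Y1 X1 X2 X3 X4 Gk.
have -> : x1 - x3 - y =
  (x1 - x2) - (g1 - x2) + (g1 - g) + (g - x4) - (x3 - x4) - y by ring.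
have T : `|(x1 - x2) - (g1 - x2) + (g1 - g) + (g - x4) - (x3 - x4) - y| <=
    (4 * r%:R + 3) * h k / v0 + `|g1 - g|.
  have -> : (4 * r%:R + 3) * h k / v0 + `|g1 - g| =
    r%:R * h k / v0 + h k / v0 + `|g1 - g| + h k / v0 + r%:R * h k / v0
      + (h k + 2 * (r%:R * h k)) / v0 by ring.
  rewrite (le_trans (ler_normB _ _))// lerD//.
  rewrite (le_trans (ler_normB _ _))// lerD//.
  rewrite (le_trans (ler_normD _ _))// lerD//.
  rewrite (le_trans (ler_normD _ _))// lerD//.
  by rewrite (le_trans (ler_normB _ _))// lerD.
rewrite (le_trans (ler_wpM2r _ T))// mulrDl mulrDr mulr1 lerD//.
have -> : (4 * r%:R + 3) * h k / v0 * `|e p| =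
  ((4 * r%:R + 3) / v0) * (`|e p| * h k) by ring.
rewrite mulrC ler_wpM2r ?hep// divr_ge0// ?ltW// addr_ge0// mulr_ge0.
Qed.

(* On the zones [c k, d k.+1) the vector X r agrees up to a small error with
   X r - Y r, because there Y r is close to Y k, whose tail is small; off the
   zones X r itself is small. *)
Lemma zone_estimate r L : james_le e (X r \- Y r) L ->
  james_le e (X r) (8 * L + eps * (r%:R * ((4 * r%:R + 3) / v0 + 1)
                              + 2 * r%:R * (1 + 2 * r%:R) + 1)).
Proof.
move=> AL.
have chX := chain c_homo X_step; have chY := chain d_homo Y_step.
set m := eps * ((4 * r%:R + 3) / v0 + 1).
have m0 : 0 <= m.
  by rewrite mulr_ge0// addr_ge0// divr_ge0// ?ltW// addr_ge0// mulr_ge0.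
have Z := @james_le_zones R E e _ L c (fun k => d k.+1) (fun=> 1) (fun=> m) r AL cd
  (fun k => ltnW (dc k.+1)).
have n1 : `|1 : R| <= 1 by rewrite normr1.
have {}Z := Z (fun=> n1) (fun=> m0) (fun k p kr pd => mass kr pd).
have Yz : james_le e (fun j => \sum_(k < r) tailn (c k) (headn (d k.+1) (Y r)) j)
    (\sum_(k < r) (eps * (1 + 2 * r%:R))).
  apply: (@james_le_sum _ _ e r (fun k => tailn (c k) (headn (d k.+1) (Y r)))
    (fun=> eps * (1 + 2 * r%:R))) => k kr.
  apply: james_leW (split_near (ltnW (cd k)) (chY _ _ (ltnW kr)) (Y_tail_c k)).
  have -> : h k + 2 * (r%:R * h k) = h k * (1 + 2 * r%:R) by ring.
  by rewrite ler_wpM2r// addr_ge0// mulr_ge0.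
have Xg : james_le e (fun j => \sum_(k < r) tailn (d k) (headn (c k) (X r)) j)
    (\sum_(k < r) (eps * (1 + 2 * r%:R))).
  apply: (@james_le_sum _ _ e r (fun k => tailn (d k) (headn (c k) (X r)))
    (fun=> eps * (1 + 2 * r%:R))) => k kr.
  apply: james_leW (split_near (ltnW (dc k)) (chX _ _ (ltnW kr)) (X_tail k)).
  have -> : eps * (1 + 2 * r%:R) = eps + 2 * (r%:R * eps) by ring.
  by rewrite lerD2l ler_wpM2l// ler_wpM2l.
(* Since [d 0 = 0], the intervals [[d k, c k)] and [[c k, d k.+1)] with [k < r] tile [[0, d r)]. The
   tail beyond [d r] gives the last [+ 1] of the bound. *)
have XE : X r = (fun j => \sum_(k < r) 1 * tailn (c k) (headn (d k.+1) (X r \- Y r)) j)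
   \+ ((fun j => \sum_(k < r) tailn (c k) (headn (d k.+1) (Y r)) j)
   \+ (fun j => \sum_(k < r) tailn (d k) (headn (c k) (X r)) j))
   \+ tailn (d r) (X r).
  apply/funext => j; rewrite /= tailnE /=.
  have -> : headn (d r) (X r) j = \sum_(k < r) (headn (d k.+1) (X r) j - headn (d k) (X r) j).
    rewrite -(big_mkord xpredT (fun k => headn (d k.+1) (X r) j - headn (d k) (X r) j)).
    by rewrite telescope_sumr// d0 /headn ltn0 subr0.
  rewrite -!big_split/=.
  under [X in _ = X + _]eq_bigr => k _.
    rewrite mul1r (tailn_headnE _ (ltnW (cd k))) (tailn_headnE _ (ltnW (cd k))).
    rewrite (tailn_headnE _ (ltnW (dc k))) !headnB /=.
    rewrite (_ : _ + _ = headn (d k.+1) (X r) j - headn (d k) (X r) j); last by ring.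
    over.
  by rewrite addrC subrK.
rewrite XE; apply: james_leW (james_leD (james_leD Z (james_leD Yz Xg)) (X_tail r)).
rewrite !sumr_const card_ord le_eqVlt; apply/orP; left; apply/eqP.
by rewrite -(mulr_natr m) -(mulr_natr (eps * _)) /m; ring.
Qed.

End zone_estimate.

(** * Interlaced paths [b < n_1 < n'_1 < n_2 < n'_2 < ...] in a tree of limits *)

Inductive interlaced (b : nat) : seq nat -> seq nat -> Prop :=
| Interlaced_nil : interlaced b [::] [::]
| Interlaced_rcons t t' n n' : interlaced b t t' -> (b < n)%N ->
    (forall x, x \in t ++ t' -> (x < n)%N) -> (n < n')%N ->
    interlaced b (rcons t n) (rcons t' n').

Lemma interlaced_size b t t' : interlaced b t t' -> size t = size t'.
Proof. by elim=> // {}t {}t' n n' _ tt' _ _ _; rewrite !size_rcons tt'. Qed.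

Section generic_paths.
Context {R : realType} {E : normedModType R} (e : nat -> E).
Context (U : set_system nat) {UU : UltraFilter U} (Uoo : \oo `<=` U).
Hypothesis e0 : e 0%N != 0.

(** Bounded completeness of (u_i) in terms of coefficients: a sequence of finite James norm is the
    norm limit of its heads. *)
Definition boundedly_complete := forall a M, james_le e a M -> forall eps, 0 < eps ->
  exists n, forall m, (n <= m)%N -> james_le e (tailn m a) eps.

Hypothesis bc : boundedly_complete.
Context (F : seq nat -> nat -> R) (M : R) (Good : seq nat -> Prop) (eps : R).
Hypothesis FM : forall t, james_le e (F t) M.
Hypothesis F_cvg : forall t j, F (rcons t n) j @[n --> U] --> F t j.
Hypothesis eps_gt0 : 0 < eps.
Hypothesis Good_next : forall t d, Good t -> \forall n \near U,
  Good (rcons t n) /\ forall p, (p < d)%N ->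
    `|ulimsum U (F (rcons t n)) - ulimsum U (F t)| * `|e p| <= eps.

Let w d := 1 + \sum_(p < d) `|e p|.
Let h d := eps / w d.

Let w_gt0 d : 0 < w d.
Proof. by rewrite ltr_pwDl// sumr_ge0. Qed.

Let h_gt0 d : 0 < h d.
Proof. by rewrite divr_gt0. Qed.

Let h_le d d' : (d <= d')%N -> h d' <= h d.
Proof.
move=> dd'; rewrite ler_pM2l// lef_pV2 ?posrE// lerD2l.
by rewrite -!(big_mkord xpredT (fun p => `|e p|)) (big_cat_nat _ dd')//= lerDl sumr_ge0.
Qed.

Let h_eps d : h d <= eps.
Proof. by rewrite ler_pdivrMr// ler_pMr// lerDl sumr_ge0. Qed.

Let h_e d p : (p < d)%N -> `|e p| * h d <= eps.
Proof.
move=> pd; rewrite /h mulrCA ler_piMr ?(ltW eps_gt0)// ler_pdivrMr// mul1r /w.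
exact: norm_le_1Dsum.
Qed.

Lemma near_headn t c x : 0 < x ->
  \forall n \near U, james_le e (headn c (F (rcons t n) \- F t)) x.
Proof.
move=> x0; pose k := c%:R * \sum_(p < c) `|e p|.
have k0 : 0 <= k by rewrite mulr_ge0// sumr_ge0.
have y0 : 0 < x / (1 + k) by rewrite divr_gt0// ltr_pwDl.
have H j : \forall n \near U, `|F (rcons t n) j - F t j| <= x / (1 + k).
  have /cvgrPdist_le /(_ _ y0) := @F_cvg t j; apply: filterS => n.
  by rewrite distrC.
apply: filterS (near_all_lt c H) => n Hn.
apply: james_leW (james_le_headn_coord e (ltW y0) Hn); rewrite -/k.
by rewrite mulrAC ler_pdivrMr ?ltr_pwDl// ler_pM2l// lerDr.
Qed.

(** Two current nodes and two cuts: [F] at the first node is at most [eps] beyond [st_d], and [F] at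
    either node is negligible beyond [st_c]. *)
Record state := State
  { st_t : seq nat ; st_t' : seq nat ; st_d : nat ; st_c : nat }.

Let inv s := [/\ Good (st_t s), (st_d s < st_c s)%N,
  james_le e (tailn (st_d s) (F (st_t s))) eps,
  james_le e (tailn (st_c s) (F (st_t s))) (h (st_d s)) &
  james_le e (tailn (st_c s) (F (st_t' s))) (h (st_d s))].

Let grows b s s1 := exists n n',
  [/\ st_t s1 = rcons (st_t s) n, st_t' s1 = rcons (st_t' s) n', (b < n)%N,
      (forall x, x \in st_t s ++ st_t' s -> (x < n)%N) & (n < n')%N].

Let close s s1 := [/\ (st_c s < st_d s1)%N,
  james_le e (headn (st_c s) (F (st_t s1) \- F (st_t s))) (h (st_d s)),
  james_le e (headn (st_d s1) (F (st_t' s1) \- F (st_t' s))) (h (st_d s)),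
  james_le e (tailn (st_d s1) (F (st_t s1))) (h (st_d s)) &
  forall p, (p < st_d s)%N ->
    `|ulimsum U (F (st_t s1)) - ulimsum U (F (st_t s))| * `|e p| <= eps].

(** The choices are made in the order [n], [d1], [n'], new [c]: a new node hardly changes [F] below
    the cut reached so far, and the next cut lies beyond the bulk of the node just chosen. *)
Let step b s : inv s -> exists s1, [/\ inv s1, grows b s s1 & close s s1].
Proof.
case: s => t t' d c [/= Gt dc Td Tc Tc'].
pose B := \max_(x <- t ++ t') x.
have H1 := Good_next d Gt; have H2 := near_headn t c (h_gt0 d).
have H3 := Uoo (nbhs_infty_gt (maxn b B)).
have [n [[[Gn Gd] Hn] /= Bn]] := filter_ex (filterI (filterI H1 H2) H3).
have [d0 Hd0] := bc (FM (rcons t n)) (h_gt0 d).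
pose d1 := maxn d0 c.+1.
have G2 := near_headn t' d1 (h_gt0 d); have G3 := Uoo (nbhs_infty_gt n).
have [n' [Hn' /= nn']] := filter_ex (filterI G2 G3).
have [c1 Hc1] := bc (FM (rcons t n)) (h_gt0 d1).
have [c2 Hc2] := bc (FM (rcons t' n')) (h_gt0 d1).
exists (State (rcons t n) (rcons t' n') d1 (maxn d1.+1 (maxn c1 c2))).
have Td1 : james_le e (tailn d1 (F (rcons t n))) (h d) by apply: Hd0; exact: leq_maxl.
split; last 1 first.
- by split => //=; rewrite /d1 leq_max ltnSn orbT.
- split => //=; first by rewrite leq_max ltnSn.
  + exact: james_leW (h_eps d) Td1.
  + by apply: Hc1; rewrite !leq_max leqnn orbT.
  + by apply: Hc2; rewrite !leq_max leqnn !orbT.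
- exists n, n'; split => //=; first by rewrite (leq_ltn_trans _ Bn)// leq_maxl.
  move=> x xt; rewrite (leq_ltn_trans _ Bn)// leq_max /B; apply/orP; right.
  by rewrite (big_rem _ xt)/= leq_maxl.
Qed.

(** Iterating [step] from the root builds two paths along which the values of [F] satisfy the
    hypotheses of [zone_estimate]. *)
Lemma generic_interlaced b r : Good [::] -> james_le e (F [::]) eps ->
  exists t t', [/\ interlaced b t t', size t = r & forall L,
    james_le e (F t \- F t') L ->
    james_le e (F t) (8 * L + eps * (r%:R * ((4 * r%:R + 3) / `|e 0%N| + 1)
                                + 2 * r%:R * (1 + 2 * r%:R) + 1))].
Proof.
move=> G0 F0.
have /choice[next Hnext] : forall s, exists s1,
    inv s -> [/\ inv s1, grows b s s1 & close s s1].
  by move=> s; have [/(step b)[s1 Hs]|ns] := pselect (inv s); [exists s1|exists s].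
have [c0 Hc0] := bc (FM [::]) (h_gt0 0).
(* With first cut 0 the invariant requires the whole of [F [::]] to be at most [eps]. *)
pose s0 := State [::] [::] 0 c0.+1.
pose s k := iter k next s0.
have Is k : inv (s k).
  elim: k => [|k /Hnext[]//]; split => //=; exact: Hc0.
have Hs k : grows b (s k) (s k.+1) /\ close (s k) (s k.+1).
  by have [] := Hnext _ (Is k).
pose T k := st_t (s k); pose T' k := st_t' (s k).
have Tint k : interlaced b (T k) (T' k).
  elim: k => [|k IH]; first exact: Interlaced_nil.
  have [[n [n' [Tn Tn' bn tn nn']]] _] := Hs k.
  by rewrite /T /T' Tn Tn'; exact: Interlaced_rcons.
have Tsize k : size (T k) = k.
  elim: k => // k IH; have [[n [n' [Tn _ _ _ _]]] _] := Hs k.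
  by rewrite /T Tn size_rcons -/(T k) IH.
exists (T r), (T' r); split => // L.
apply: (@zone_estimate R E e U UU Uoo e0 (fun k => F (T k)) (fun k => F (T' k))
  (fun k => st_c (s k)) (fun k => st_d (s k)) (fun k => h (st_d (s k))) eps M) => //.
- by move=> k; case: (Is k).
- by move=> k; case: (Hs k) => _ [].
- exact: ltW.
- by move=> k; exact: ltW.
- move=> k; apply: h_le; have [_ dc _ _ _] := Is k; have [_ [cd _ _ _ _]] := Hs k.
  exact: ltnW (ltn_trans dc cd).
- by move=> k p; exact: h_e.
- by move=> k; case: (Is k).
- by move=> k; case: (Is k).
- by move=> k; case: (Is k).
- by move=> k; case: (Hs k) => _ [].
- by move=> k; case: (Hs k) => _ [].
- by move=> k; case: (Hs k) => _ [].
- by move=> k p; case: (Hs k) => _ [_ _ _ _]; apply.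
Qed.

End generic_paths.

(** Cantor's diagonal argument: if [f] were injective, the set [D] of codes would contradict itself
    at the code of [f D]. *)
Lemma cantor_collision (T : countType) (f : (nat -> bool) -> T) :
  exists x y, x <> y /\ f x = f y.
Proof.
apply: contrapT => nf.
have finj x y : f x = f y -> x = y.
  by move=> fxy; apply: contrapT => xy; apply: nf; exists x, y.
pose D n := ~~ `[< exists x, pickle (f x) = n /\ x n >].
case DD : (D (pickle (f D))).
  have := DD; rewrite {1}/D => /asboolPn; apply; exists D; split => //.
have /negbFE/asboolP[x [/(pcan_inj pickleK)/finj ->]] := DD.
by rewrite DD.
Qed.

(** * The test vectors in c_0 *)

Section summing_vectors.
Context {R : realType}.
Implicit Types (x y : nat -> bool) (t : seq nat).

(** The sum over the entries [n] of [t] of the 0-1 sequence [x] cut to [[0, n)]. *)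
Definition summing_seq x t : nat -> R :=
  fun k => if x k then (count (fun n => (k < n)%N) t)%:R else 0.

Lemma summing_seq_null x t : summing_seq x t \in null_seq.
Proof.
apply/null_seqP; apply: cvg_near_cst; near=> k.
rewrite /summing_seq; case: ifP => // _.
rewrite (_ : count _ _ = 0%N)//; apply/eqP; rewrite -leqn0 leqNgt -has_count.
apply/hasPn => n nt; rewrite -leqNgt.
apply: (@leq_trans (\max_(n <- t) n)).
  by rewrite (big_rem _ nt)/= leq_maxl.
near: k; exact: nbhs_infty_ge.
Unshelve. all: by end_near. Qed.

Definition summing x t : c0 R := C0 (summing_seq_null x t).

Lemma norm_summing_le x t : `|summing x t| <= (size t)%:R.
Proof.
apply: c0_norm_le => k; rewrite /= /summing_seq; case: ifP => _; last by rewrite normr0.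
by rewrite ger0_norm// ler_nat count_size.
Qed.

(** At the coordinate [k] one of the two vectors takes the value [size t] and the other 0. *)
Lemma norm_summingB_ge x y t k : x k != y k -> (forall n, n \in t -> (k < n)%N) ->
  (size t)%:R <= `|summing x t - summing y t|.
Proof.
move=> xy kt; apply: le_trans (c0_norm_ub _ k).
have ct : count (fun n => (k < n)%N) t = size t.
  by apply/eqP; rewrite -all_count; apply/allP => n /kt.
have -> : (summing x t - summing y t) k = summing_seq x t k - summing_seq y t k by [].
rewrite /summing_seq ct.
move: xy; case: (x k); case: (y k) => // _; rewrite ?subr0 ?sub0r ?normrN; exact: ler_norm.
Qed.

(** At most one index [i] satisfies [n_i <= k < n'_i], and only such an index makes the counts
    differ. *)
Lemma interlaced_count b t t' k : interlaced b t t' ->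
  (count (fun n => (k < n)%N) t <= count (fun n => (k < n)%N) t'
    <= (count (fun n => (k < n)%N) t).+1)%N.
Proof.
elim=> // {}t {}t' n n' _ IH bn tn nn'; rewrite -!cats1 !count_cat/= !addn0.
have [kn|nk] := ltnP k n.
  by rewrite (ltn_trans kn nn'); move: IH; lia.
have c0 s : {subset s <= t ++ t'} -> count (fun n => (k < n)%N) s = 0%N.
  move=> st; apply/eqP; rewrite -leqn0 leqNgt -has_count; apply/hasPn => m /st /tn.
  by lia.
rewrite !c0; last 2 first.
- by move=> m mt; rewrite mem_cat mt orbT.
- by move=> m mt; rewrite mem_cat mt.
by case: (k < n')%N.
Qed.

Lemma norm_summing_interlaced b x t t' : interlaced b t t' ->
  `|summing x t - summing x t'| <= 1.
Proof.
move=> tt'; apply: c0_norm_le => k.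
have -> : (summing x t - summing x t') k = summing_seq x t k - summing_seq x t' k by [].
rewrite /summing_seq; case: ifP => _; last by rewrite subrr normr0.
have /andP[h1 h2] := interlaced_count k tt'.
rewrite distrC -natrB// ger0_norm// -[leRHS]/(1%:R) ler_nat; lia.
Qed.

End summing_vectors.

Lemma interlaced_gt b t t' n : interlaced b t t' -> n \in t -> (b < n)%N.
Proof.
elim=> // {}t {}t' m m' _ IH bm _ _; rewrite mem_rcons inE => /predU1P[->//|].
exact: IH.
Qed.

(** * Trees of iterated limits and their masses *)

Section no_coarse_embedding.
Context {R : realType} {E : normedModType R} (e : nat -> E).
Hypothesis e0 : e 0%N != 0.
Hypothesis bc : boundedly_complete e.

Let v0 := `|e 0%N|.
Let v0_gt0 : 0 < v0. Proof. by rewrite normr_gt0. Qed.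

Lemma james_le_coord (a : nat -> R) M j : james_le e a M -> `|a j| <= 2 * (M / v0).
Proof.
move=> aM.
have -> : a j = isum a 0 j.+1 - isum a 0 j.
  by rewrite /isum big_nat_recr//= addrAC subrr add0r.
rewrite (le_trans (ler_normB _ _))// mulr_natl mulr2n lerD// isum_norm_le//.
Qed.

Section ultrafilter.
Context (U : set_system nat) {UU : UltraFilter U} (Uoo : \oo `<=` U).

Section iterated_limits.
Context (psi : c0 R -> nat -> R) (r : nat) (M : R).
Hypothesis psiM : forall x t, (size t <= r)%N -> james_le e (psi (summing x t)) M.
Implicit Types (x : nat -> bool) (t : seq nat).

(** The iterated limit over [k] further entries. Because of [take r] the tree is constant past depth
    [r], and [psiM] bounds every node. *)
Fixpoint iter_ulim (k : nat) x t : nat -> R :=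
  if k is k'.+1 then fun j => ulim U (fun n => iter_ulim k' x (rcons t n) j)
  else psi (summing x (take r t)).

Lemma iter_ulim_james_le k x t : james_le e (iter_ulim k x t) M.
Proof.
elim: k t => [|k IH] t /=.
  by apply: psiM; rewrite size_take; case: ltnP => //; exact: ltnW.
apply: (@james_le_ulim R E e U _ (fun n => iter_ulim k x (rcons t n))) => // j.
by apply: ulim_cvg => n; apply: james_le_coord; exact: IH.
Qed.

Definition limit_tree x t := iter_ulim (r - size t) x t.

Lemma limit_tree_james_le x t : james_le e (limit_tree x t) M.
Proof. exact: iter_ulim_james_le. Qed.

Lemma limit_tree_leaf x t : size t = r -> limit_tree x t = psi (summing x t).
Proof. by move=> tr; rewrite /limit_tree tr subnn /= -tr take_size. Qed.

Lemma limit_tree_const x t n : (r <= size t)%N ->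
  limit_tree x (rcons t n) = limit_tree x t.
Proof.
move=> rt; rewrite /limit_tree size_rcons (eqP (rt : r - size t == 0)%N).
rewrite (eqP (leqW rt : r - (size t).+1 == 0)%N) /=.
by rewrite -cats1 takel_cat.
Qed.

Lemma limit_tree_cvg x t j :
  limit_tree x (rcons t n) j @[n --> U] --> limit_tree x t j.
Proof.
have [tr|rt] := ltnP (size t) r; last first.
  under [X in X @ _]eq_fun do rewrite limit_tree_const//.
  exact: cvg_cst.
rewrite [limit_tree x t]/limit_tree (_ : r - size t = (r - (size t).+1).+1)%N; last by lia.
have -> : (fun n => limit_tree x (rcons t n) j) =
    (fun n => iter_ulim (r - (size t).+1) x (rcons t n) j).
  by apply/funext => n; rewrite /limit_tree size_rcons.
by apply: ulim_cvg => n; apply: james_le_coord; exact: iter_ulim_james_le.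
Qed.

(** The iterated limit of the total masses of the nodes [m] levels below [t]. Total mass need not
    commute with coordinatewise limits, so varying [m] records the mass that escapes to infinity. *)
Fixpoint iter_mass (m : nat) x t : R :=
  if m is m'.+1 then ulim U (fun n => iter_mass m' x (rcons t n))
  else ulimsum U (limit_tree x t).

Lemma iter_mass_le m x t : `|iter_mass m x t| <= M / v0.
Proof.
elim: m t => [|m IH] t /=; last by apply: ulim_norm_le => n; exact: IH.
by apply: ulimsum_norm_le => //; exact: limit_tree_james_le.
Qed.

Lemma iter_mass_cvg m x t : iter_mass m x (rcons t n) @[n --> U] --> iter_mass m.+1 x t.
Proof. by apply: ulim_cvg => n; exact: iter_mass_le. Qed.

End iterated_limits.
End ultrafilter.
End no_coarse_embedding.

(** * Masses in the difference of two trees *)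

Section colliding_trees.
Context {R : realType} {E : normedModType R} (e : nat -> E).
Hypothesis e0 : e 0%N != 0.
Context (U : set_system nat) {UU : UltraFilter U} (Uoo : \oo `<=` U).
Context (psi : c0 R -> nat -> R) (r : nat) (M : R).
Hypothesis psiM : forall (x : nat -> bool) t,
  (size t <= r)%N -> james_le e (psi (summing x t)) M.
Context (x y : nat -> bool).

Let mass m t := iter_mass U psi r m x t - iter_mass U psi r m y t.
Let F t := limit_tree U psi r x t \- limit_tree U psi r y t.

Let FM t : james_le e (F t) (M + M).
Proof. by apply: james_leB; exact: limit_tree_james_le. Qed.

Let F_cvg t j : F (rcons t n) j @[n --> U] --> F t j.
Proof. by apply: cvgB; exact: (limit_tree_cvg e0 psiM). Qed.

Let F_mass t : ulimsum U (F t) = mass 0 t.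
Proof.
by rewrite /F (ulimsumB e0 (limit_tree_james_le e0 psiM x t) (limit_tree_james_le e0 psiM y t)).
Qed.

(** A node is good if the limits [mass m] of all remaining levels are small there. Goodness passes
    to generic children because [mass m.+1 t] is the limit of [mass m] at the children of [t]. *)
Let good_bounded (B eps : R) : 0 < eps -> 0 <= B -> (forall p, `|e p| <= B) ->
  (forall m, (m <= r)%N -> `|mass m [::]| < eps / (2 * (1 + B))) ->
  exists Good : seq nat -> Prop, Good [::] /\ forall t d, Good t ->
    \forall n \near U, Good (rcons t n) /\ forall p, (p < d)%N ->
      `|ulimsum U (F (rcons t n)) - ulimsum U (F t)| * `|e p| <= eps.
Proof.
move=> eps0 B0 eB mass0; set x1 := eps / _ in mass0.
exists (fun t => forall m, (m <= r - size t)%N -> `|mass m t| < x1); split.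
  by move=> m; rewrite subn0; exact: mass0.
move=> t d Gt.
have H m : \forall n \near U, (m <= r - (size t).+1)%N -> `|mass m (rcons t n)| < x1.
  have [mr|mr] := leqP m (r - (size t).+1); last by apply: filterE => n.
  have [tr|rt] := ltnP (size t) r.
    have cv : mass m (rcons t n) @[n --> U] --> mass m.+1 t.
      by apply: cvgB; exact: (iter_mass_cvg e0 psiM).
    have lt1 : `|mass m.+1 t| < x1 by apply: Gt; lia.
    by apply: filterS (cvgr_lt _ (cvg_norm cv) _ lt1) => n.
  (* Past depth [r] only the level 0 remains, and the trees are constant. *)
  have -> : m = 0%N by lia.
  apply: filterE => n _; rewrite /mass /= !limit_tree_const//.
  exact: (Gt 0%N (leq0n _)).
apply: filterS (near_all_lt r.+1 H) => n Hn.
have Gn m : (m <= r - size (rcons t n))%N -> `|mass m (rcons t n)| < x1.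
  by rewrite size_rcons => mr; apply: Hn => //; lia.
split=> // p _; rewrite !F_mass.
have h1 := Gn 0%N (leq0n _); have h2 := Gt 0%N (leq0n _).
apply: (@le_trans _ _ ((x1 + x1) * (1 + B))).
  apply: ler_pM => //; last by rewrite (le_trans (eB p))// lerDr.
  by rewrite (le_trans (ler_normB _ _))// lerD// ltW.
rewrite le_eqVlt; apply/orP; left; apply/eqP; rewrite /x1; field.
by rewrite gt_eqF// ltr_pwDl.
Qed.

(* If the norms of the e_p are unbounded, sums of intervals starting at p with
   |e_p| large are small, so that no mass can escape to infinity. *)
Let good_unbounded (eps : R) : 0 < eps -> (forall C, exists p, C < `|e p|) ->
  forall t d, \forall n \near U, forall p, (p < d)%N ->
      `|ulimsum U (F (rcons t n)) - ulimsum U (F t)| * `|e p| <= eps.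
Proof.
move=> eps0 eub t d; pose w : R := 1 + \sum_(p < d) `|e p|.
have w0 : 0 < w by rewrite ltr_pwDl// sumr_ge0.
(* For this [q] the mass beyond [q] is at most [eps / (4 * w)] at every node, and the sums below [q]
   converge along [U]. *)
have [q] := eub (4 * (M + M) * w / eps).
have M0 : 0 <= M + M := james_le_ge0 (FM [::]).
rewrite ltr_pdivrMr// => qe.
have eq0 : 0 < `|e q|.
  rewrite -(pmulr_rgt0 _ eps0) mulrC (le_lt_trans _ qe)// mulr_ge0//; last exact: ltW.
  by rewrite mulr_ge0.
have tail_small s : `|ulimsum U (F s) - isum (F s) 0 q| <= eps / (4 * w).
  rewrite ler_pdivlMr ?mulr_gt0// -(ler_pM2r eq0).
  rewrite mulrAC (le_trans (ler_wpM2r _ (ulimsum_norm _ _ _ (FM s))))//.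
    by rewrite mulr_ge0// ltW.
  by rewrite mulrC [leRHS]mulrC (le_trans _ (ltW qe))// mulrAC.
have x0 : 0 < eps / (2 * w) by rewrite divr_gt0// mulr_gt0.
have Fq : isum (F (rcons t n)) 0 q @[n --> U] --> isum (F t) 0 q.
  by apply: cvg_isum => j; exact: F_cvg.
have /cvgrPdist_le /(_ _ x0) Ft := Fq.
apply: filterS Ft => n Hn p pd.
have epw : `|e p| <= w by exact: norm_le_1Dsum.
apply: (@le_trans _ _ (eps / w * w)); last by rewrite divfK ?gt_eqF.
apply: ler_pM => //.
have -> : ulimsum U (F (rcons t n)) - ulimsum U (F t) =
  (ulimsum U (F (rcons t n)) - isum (F (rcons t n)) 0 q)
  - (isum (F t) 0 q - isum (F (rcons t n)) 0 q)
  - (ulimsum U (F t) - isum (F t) 0 q) by ring.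
have -> : eps / w = eps / (4 * w) + eps / (2 * w) + eps / (4 * w).
  by field; rewrite gt_eqF.
rewrite (le_trans (ler_normB _ _))// lerD// (le_trans (ler_normB _ _))// lerD//.
Qed.

Lemma good_nodes (B eps : R) : 0 < eps -> 0 <= B ->
  (forall p, `|e p| <= B) \/ (forall C, exists p, C < `|e p|) ->
  (forall m, (m <= r)%N ->
    `|iter_mass U psi r m x [::] - iter_mass U psi r m y [::]| < eps / (2 * (1 + B))) ->
  exists Good : seq nat -> Prop, Good [::] /\ forall t d, Good t ->
    \forall n \near U, Good (rcons t n) /\ forall p, (p < d)%N ->
      `|ulimsum U (F (rcons t n)) - ulimsum U (F t)| * `|e p| <= eps.
Proof.
move=> eps0 B0 [eB|eub] m0; first exact: good_bounded eB m0.
exists (fun=> True); split => // t d _.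
by apply: filterS (good_unbounded eps0 eub t d).
Qed.

End colliding_trees.

Lemma floor_eq_dist {R : realType} (a b c : R) : 0 < c ->
  Num.floor (a / c) = Num.floor (b / c) -> `|a - b| < c.
Proof.
move=> c0 fab; have := floor_itv (a / c); have := floor_itv (b / c).
rewrite -fab intrD => /andP[b1 b2] /andP[a1 a2].
rewrite -[ltRHS]mul1r -ltr_pdivrMr// -(gtr0_norm c0) -normrV ?unitfE ?gt_eqF//.
rewrite -normrM mulrBl ltr_distl; apply/andP; split; lra.
Qed.

(** * No coarse map in the boundedly complete case *)

Section no_coarse_embedding_main.
Context {R : realType} {E : normedModType R} (e : nat -> E).
Hypothesis e0 : e 0%N != 0.
Hypothesis bc : boundedly_complete e.

(** By bounded completeness finitely many integers describe the limit and the masses of [x] to the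
    required precision; there are countably many such codes but uncountably many [x]. *)
Lemma colliding_approx (U : set_system nat) (UU : UltraFilter U)
    (psi : c0 R -> nat -> R) (r : nat) (M eps delta : R) :
  0 < eps -> 0 < delta ->
  (forall (x : nat -> bool) t, (size t <= r)%N -> james_le e (psi (summing x t)) M) ->
  exists x y, [/\ x <> y,
    james_le e (limit_tree U psi r x [::] \- limit_tree U psi r y [::]) eps &
    forall m, (m <= r)%N ->
      `|iter_mass U psi r m x [::] - iter_mass U psi r m y [::]| < delta].
Proof.
move=> eps0 delta0 psiM.
pose F x := limit_tree U psi r x [::].
have FM x : james_le e (F x) M by exact: limit_tree_james_le.
have e4 : 0 < eps / 4 by rewrite divr_gt0.
have /choice[N HN] : forall x, exists n, james_le e (tailn n (F x)) (eps / 4).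
  by move=> x; have [n Hn] := bc (FM x) e4; exists n; exact: Hn.
pose k n : R := n%:R * \sum_(p < n) `|e p|.
have k0 n : 0 <= k n by rewrite mulr_ge0// sumr_ge0.
(* Errors [tau n] in the first [n] coordinates amount to at most [eps / 2]; the two tails take the
   other half. *)
pose tau n := eps / 2 / (1 + k n).
have tau0 n : 0 < tau n by rewrite !divr_gt0// ltr_pwDl.
pose code x := (N x, [seq Num.floor (F x j / tau (N x)) | j <- iota 0 (N x)],
  [seq Num.floor (iter_mass U psi r m x [::] / delta) | m <- iota 0 r.+1]).
have [x [y [xy cxy]]] := cantor_collision code.
have Nxy : N x = N y := congr1 (fun z => z.1.1) cxy.
have Fxy := congr1 (fun z => z.1.2) cxy; have mxy := congr1 snd cxy.
rewrite /code /fst /snd in Fxy mxy.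
exists x, y; split => //.
  have -> : limit_tree U psi r x [::] \- limit_tree U psi r y [::] =
      headn (N x) (F x \- F y) \+ (tailn (N x) (F x) \- tailn (N x) (F y)).
    apply/funext => j; rewrite /= headnB !tailnE /= -/(F x) -/(F y).
    ring.
  have -> : eps = eps / 2 + (eps / 4 + eps / 4) by field.
  apply: james_leD; last by apply: james_leB; [exact: HN|rewrite Nxy; exact: HN].
  have Hj j : (j < N x)%N -> `|(F x \- F y) j| <= tau (N x).
    move=> jN; apply/ltW/floor_eq_dist => //.
    have := congr1 (fun s => nth 0 s j) Fxy.
    by rewrite !(nth_map 0%N) ?size_iota// -?Nxy// !nth_iota// -?Nxy.
  apply: james_leW (james_le_headn_coord e (ltW (tau0 _)) Hj); rewrite -/(k _).
  by rewrite /tau mulrAC ler_pdivrMr ?ltr_pwDl// ler_pM2l ?divr_gt0// lerDr.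
move=> m mr; apply: floor_eq_dist => //.
have := congr1 (fun s => nth 0 s m) mxy.
by rewrite !(nth_map 0%N) ?size_iota ?ltnS// !nth_iota ?ltnS.
Qed.

Lemma no_coarse_map (psi : c0 R -> nat -> R) (rho omega : R -> R) :
  (forall s t, 0 <= s -> s <= t -> rho s <= rho t /\ omega s <= omega t) ->
  rho t @[t --> +oo] --> +oo ->
  (forall v w, james_le e (psi v \- psi w) (omega `|v - w| + 2)) ->
  (forall v w K, james_le e (psi v \- psi w) K -> rho `|v - w| <= K + 2) ->
  False.
Proof.
move=> ro_homo rho_oo psi_up psi_lo.
have [U [UU Uoo]] := ultraFilterLemma (F := \oo) _.
pose L : R := omega 1 + 2 + (omega 1 + 2).
(* [L] will bound [F t \- F t'] at interlaced leaves and does not depend on [r]. The choice of [eps]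
   after [r] makes the error in [generic_interlaced] equal to 1, and [psi_lo] adds 2. *)
have [r rL] : exists r : nat, 8 * L + 3 < rho r%:R.
  have /cvgryPgt/(_ (8 * L + 3)) : rho n%:R @[n --> \oo] --> +oo.
    exact: cvg_comp (@cvgr_idn R) rho_oo.
  by move=> /filter_ex[r Hr]; exists r.
pose C : R := r%:R * ((4 * r%:R + 3) / `|e 0%N| + 1) + 2 * r%:R * (1 + 2 * r%:R) + 1.
have C0 : 0 < C.
  by rewrite ltr_wpDl// addr_ge0 ?mulr_ge0 ?addr_ge0 ?divr_ge0 ?addr_ge0 ?mulr_ge0.
pose eps := C^-1; have eps0 : 0 < eps by rewrite invr_gt0.
have [B [B0 HB]] : exists B : R, 0 <= B /\
    ((forall p, `|e p| <= B) \/ (forall C, exists p, C < `|e p|)).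
  have [[B HB]|nB] := pselect (exists B : R, forall p, `|e p| <= B).
    by exists B; split; [exact: le_trans (HB 0%N)|left].
  exists 0; split => //; right => D; apply: contrapT => nD; apply: nB; exists D => p.
  by rewrite leNgt; apply/negP => Dp; apply: nD; exists p.
pose psi0 v := psi v \- psi 0.
have psiM (x : nat -> bool) t : (size t <= r)%N ->
    james_le e (psi0 (summing x t)) (omega r%:R + 2).
  move=> tr; apply: james_leW (psi_up _ _); rewrite lerD2r subr0.
  apply: (ro_homo _ _ _ _).2; first exact: normr_ge0.
  by rewrite (le_trans (norm_summing_le x t))// ler_nat.
have d0 : 0 < eps / (2 * (1 + B)) by rewrite divr_gt0// mulr_gt0// ltr_pwDl.
have [x [y [xy Fxy mxy]]] := colliding_approx UU eps0 d0 psiM.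
have [k xyk] : exists k, x k != y k.
  apply: contrapT => nk; apply: xy; apply/funext => k; apply/eqP.
  by apply/negPn/negP => xyk; apply: nk; exists k.
pose F t := limit_tree U psi0 r x t \- limit_tree U psi0 r y t.
have [Good [G0 Gnext]] := good_nodes e0 Uoo psiM eps0 B0 HB mxy.
have FM t : james_le e (F t) (omega r%:R + 2 + (omega r%:R + 2)).
  by apply: james_leB; exact: limit_tree_james_le.
have F_cvg t j : F (rcons t n) j @[n --> U] --> F t j.
  by apply: cvgB; exact: (limit_tree_cvg e0 psiM).
(* The entries are kept above [k], where [x] and [y] differ, so that the points of c_0 are at
   distance at least [r]. *)
have [t [t' [tt' tr Ht]]] :=
  generic_interlaced Uoo e0 bc FM F_cvg eps0 Gnext k r G0 Fxy.
have tr' : size t' = r by rewrite -(interlaced_size tt').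
have FE s : size s = r -> F s = psi (summing x s) \- psi (summing y s).
  move=> sr; rewrite /F !limit_tree_leaf//; apply/funext => j.
  by rewrite /= /psi0 /=; ring.
have AL : james_le e (F t \- F t') L.
  have -> : F t \- F t' = (psi (summing x t) \- psi (summing x t'))
      \- (psi (summing y t) \- psi (summing y t')).
    by rewrite !FE//; apply/funext => j /=; ring.
  by apply: james_leB; apply: james_leW (psi_up _ _); rewrite lerD2r;
    apply: (ro_homo _ _ _ _).2 => //; exact: norm_summing_interlaced tt'.
have := Ht L AL; rewrite FE// -/C /eps mulVf ?gt_eqF// => /psi_lo.
apply/negP; rewrite -ltNge.
have -> : 8 * L + 1 + 2 = 8 * L + 3 by ring.
apply: (lt_le_trans rL); apply: (ro_homo _ _ _ _).1 => //.
rewrite -{1}tr; apply: norm_summingB_ge xyk _ => n; exact: interlaced_gt tt'.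
Qed.

End no_coarse_embedding_main.

(** * Linear embeddings of c_0 *)

Section linear_embeddings.
Context {R : realType}.

(** A linear embedding is bilipschitz; the lower estimate follows by homogeneity from the continuity
    of [S] at 0 within the range. *)
Lemma linear_coarse (X Y : normedModType R) : linearly_embeds X Y -> coarsely_embeds X Y.
Proof.
move=> [T [S [Tc _ TS Sc]]]; exists T.
have [K K0 TK] : exists2 K : R, 0 < K & forall x, `|T x| <= K * `|x|.
  have /linear_boundedP [K [_ HK]] := continuous_linear_bounded 0 (Tc 0).
  exists (Num.max (K + 1) 1) => [|x]; first by rewrite lt_max ltr01 orbT.
  by apply: HK; rewrite lt_max ltrDl ltr01.
have [c c0 Tlow] : exists2 c : R, 0 < c & forall x, c * `|x| <= `|T x|.
  have S0 : S 0 = 0 by rewrite -[X in S X](linear0 T) TS.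
  have rT0 : range T 0 by exists 0 => //; exact: linear0.
  have S_cvg : S @ within (range T) (nbhs (0 : Y)) --> S 0.
    by move/subspace_continuousP : Sc => /(_ _ rT0).
  move: S_cvg; rewrite S0 => /cvgrPdist_lt/(_ 1 ltr01).
  rewrite near_withinE => /nbhs_ballP[d /= d0 Hd].
  exists (d / 2) => [|x]; first by rewrite divr_gt0.
  have [->|x0] := eqVneq x 0; first by rewrite normr0 mulr0.
  rewrite leNgt; apply/negP => Tx.
  have nx : 0 < `|x| by rewrite normr_gt0.
  have := Hd (T (`|x|^-1 *: x)); rewrite -ball_normE /= sub0r normrN.
  rewrite linearZ normrZ ger0_norm ?invr_ge0//.
  have H1 : `|x|^-1 * `|T x| < d.
    rewrite mulrC ltr_pdivrMr// (lt_trans Tx)// ltr_pM2r// gtr_pMr// invf_lt1//; lra.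
  have rTx : range T (`|x|^-1 *: T x).
    by exists (`|x|^-1 *: x) => //; rewrite linearZ.
  move=> /(_ H1 rTx); rewrite -linearZ TS sub0r normrN normrZ.
  by rewrite ger0_norm ?invr_ge0// mulVf ?gt_eqF// ltxx.
exists (fun t => c * t), (fun t => K * t); split.
- by move=> t t0; rewrite !mulr_ge0// ltW.
- by move=> s t s0 st; rewrite !ler_pM2l.
- apply/cvgryPge => A; near=> t.
  by rewrite mulrC -ler_pdivrMr//; near: t; exact: nbhs_pinfty_ge.
- by move=> x y; rewrite -linearB Tlow TK.
Unshelve. all: by end_near. Qed.

(** The embedding sends [x] to the sum of the [x k *: z k]. The upper estimate, scaled to tails of
    [x], makes the series Cauchy; the lower one makes the inverse Lipschitz. *)
Lemma c0_embeds (J : completeNormedModType R) (z : nat -> J) (A c : R) : 0 < c ->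
  (forall (w : nat -> R) K, (forall k, `|w k| <= 1) -> `|\sum_(k < K) w k *: z k| <= A) ->
  (forall (w : nat -> R) K l, (l < K)%N -> c * `|w l| <= `|\sum_(k < K) w k *: z k|) ->
  linearly_embeds (c0 R) J.
Proof.
move=> c_gt0 up lo.
have A0 : 0 <= A.
  by apply: le_trans (up (fun=> 0) 0%N _) => // k; rewrite normr0.
have upt (x : nat -> R) m n (t : R) : 0 < t -> (forall k, (m <= k)%N -> `|x k| <= t) ->
    `|\sum_(m <= k < n) x k *: z k| <= t * A.
  move=> t0 xt; have [mn|/ltnW nm] := leqP m n; last first.
    by rewrite big_geq// normr0 mulr_ge0// ltW.
  pose w k := if (m <= k)%N then x k / t else 0.
  have -> : \sum_(m <= k < n) x k *: z k = t *: \sum_(k < n) w k *: z k.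
    rewrite scaler_sumr -(big_mkord xpredT (fun k => t *: (w k *: z k))).
    rewrite [RHS](big_cat_nat (leq0n m) mn)/= [X in _ = X + _]big_nat.
    rewrite [X in _ = X + _]big1; last first.
      by move=> k /andP[_ km]; rewrite /w leqNgt km scale0r scaler0.
    rewrite add0r big_nat [RHS]big_nat; apply: eq_bigr => k /andP[mk _].
    by rewrite /w mk scalerA mulrC divfK ?gt_eqF.
  rewrite normrZ gtr0_norm// ler_pM2l//; apply: up => k.
  rewrite /w; case: ifP => [mk|_]; last by rewrite normr0.
  by rewrite normrM normfV (gtr0_norm t0) ler_pdivrMr// mul1r xt.
pose s (x : c0 R) := series (fun k => x k *: z k).
have s_cvg x : cvgn (s x).
  apply: cauchy_cvg; apply/cauchy_seriesP => eps eps0.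
  have t0 : 0 < eps / 2 / (1 + A) by rewrite !divr_gt0// ltr_pwDl.
  have /null_seqP/cvgrPdist_le/(_ _ t0)[m _ Hm] := c0_valP x.
  exists ([set n | (m <= n)%N], setT) => /=.
    by split; [exact: nbhs_infty_ge|exact: filterT].
  move=> [p q] /= [mp _]; apply: (@le_lt_trans _ _ (eps / 2)); last by lra.
  apply: (@le_trans _ _ (eps / 2 / (1 + A) * A)).
    apply: upt => // k pk; have := Hm k (leq_trans mp pk).
    by rewrite /= sub0r normrN.
  by rewrite mulrAC ler_pdivrMr ?ltr_pwDl// ler_pM2l ?divr_gt0// lerDr.
pose T0 (x : c0 R) : J := limn (s x).
have T_lin : linear T0.
  move=> a x y; rewrite /T0.
  have -> : s (a *: x + y) = (fun n => a *: s x n) \+ s y.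
    apply/funext => n; rewrite /s /series /= scaler_sumr -big_split/=.
    by apply: eq_bigr => k _; rewrite scalerDl scalerA.
  by apply: cvg_lim => //; apply: cvgD; [apply: cvgZl_tmp|]; exact: s_cvg.
pose T : {linear c0 R -> J} := HB.pack T0 (GRing.isLinear.Build _ _ _ _ T0 T_lin).
have T_up x : `|T x| <= A * `|x|.
  have [->|x0] := eqVneq x 0; first by rewrite linear0 !normr0 mulr0.
  have /cvg_norm Tx := s_cvg x.
  apply: (cvgr_to_le Tx); apply: filterE => n; rewrite mulrC.
  apply: upt; first by rewrite normr_gt0.
  by move=> k _; exact: c0_norm_ub.
have T_lo x : c * `|x| <= `|T x|.
  rewrite mulrC -ler_pdivlMr//; apply: c0_norm_le => l; rewrite ler_pdivlMr// mulrC.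
  have /cvg_norm Tx := s_cvg x.
  apply: (cvgr_to_ge Tx); near=> n.
  by rewrite /s /series /= big_mkord; apply: lo; near: n; exact: nbhs_infty_gt.
have T_dist x y : `|x - y| <= `|T x - T y| / c.
  by rewrite ler_pdivlMr// mulrC -linearB.
have T_inj x y : T x = T y -> x = y.
  move=> Txy; apply/eqP; rewrite -subr_eq0 -normr_le0 (le_trans (T_dist x y))//.
  by rewrite Txy subrr normr0 mul0r.
have /choice[S HS] : forall y, exists x, range T y -> T x = y.
  by move=> y; have [[x _ <-]|nr] := pselect (range T y); [exists x|exists 0].
exists T, S; split.
- apply: bounded_linear_continuous; apply/linear_boundedP.
  apply: filterS (nbhs_pinfty_ge (num_real A)) => r Ar x.
  by apply: le_trans (T_up x) _; rewrite ler_wpM2r.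
(* Approximate preimages [xs] of [y] are uniformly Cauchy, so their coordinatewise limit is again a
   null sequence and is mapped to [y]. *)
- rewrite closedE => y Ny.
  have {}Ny (eps : R) : 0 < eps -> exists x, `|y - T x| <= eps.
    move=> eps0; apply: contrapT => nx; apply: Ny; near=> y' => -[x _ Txy].
    apply: nx; exists x; rewrite Txy; near: y'.
    exact: cvgr_dist_le eps0.
  have inv0 n : 0 < (n.+1%:R)^-1 :> R by rewrite invr_gt0.
  have /choice[xs Hxs] : forall n, exists x, `|y - T x| <= (n.+1%:R)^-1.
    by move=> n; exact: Ny.
  pose b (n : nat) : R := 2 * (n.+1%:R)^-1 / c.
  have xs_dist n m k : (n <= m)%N -> `|xs n k - xs m k| <= b n.
    move=> nm; apply: le_trans (c0_norm_ub (xs n - xs m) k) _.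
    apply: le_trans (T_dist _ _) _; rewrite ler_pM2r ?invr_gt0//.
    have -> : T (xs n) - T (xs m) = (y - T (xs m)) - (y - T (xs n)).
      by rewrite opprB [RHS]addrC subrKA.
    rewrite (le_trans (ler_normB _ _))// mulr_natl mulr2n lerD// (le_trans (Hxs m))//.
    by rewrite lef_pV2 ?posrE// ler_nat.
  have [U [UU Uoo]] := ultraFilterLemma (F := \oo) _.
  pose l k := ulim U (fun n => xs n k).
  have l_cvg k : xs n k @[n --> U] --> l k.
    apply: (@ulim_cvg _ _ _ _ (`|xs 0%N k| + b 0%N)) => n.
    have -> : xs n k = xs 0%N k - (xs 0%N k - xs n k) by rewrite opprB addrC subrK.
    by rewrite (le_trans (ler_normB _ _))// lerD2l xs_dist.
  have l_dist n k : `|xs n k - l k| <= b n.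
    have H : `|xs n k - xs m k| @[m --> U] --> `|xs n k - l k|.
      by apply: cvg_norm; apply: cvgB; [exact: cvg_cst|exact: l_cvg].
    apply: (cvgr_to_le H); apply: filterS (Uoo _ (nbhs_infty_ge n)) => m /=.
    exact: xs_dist.
  have b_small (eps : R) : 0 < eps -> exists n, b n <= eps.
    move=> eps0; have /filter_ex[n Hn] : \forall n \near \oo, 2 / c / eps <= n%:R.
      exact: nbhs_infty_ger.
    exists n; rewrite /b mulrAC ler_pdivrMr// [leRHS]mulrC -ler_pdivrMr//.
    by rewrite (le_trans Hn)// ler_nat.
  have l0 : l \in null_seq.
    apply/null_seqP/cvgrPdist_le => eps eps0.
    have e2 : 0 < eps / 2 by rewrite divr_gt0.
    have [n Hn] := b_small _ e2.
    have /null_seqP/cvgrPdist_le/(_ _ e2) := c0_valP (xs n).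
    apply: filterS => k; rewrite !sub0r !normrN => Hk.
    have -> : l k = xs n k - (xs n k - l k) by rewrite opprB addrC subrK.
    rewrite (le_trans (ler_normB _ _))// [leRHS](splitr eps) lerD//.
    exact: le_trans (l_dist n k) Hn.
  exists (C0 l0) => //; apply/esym/eqP; rewrite -subr_eq0 -normr_le0.
  apply/ler_addgt0Pr => eps eps0; rewrite add0r.
  have d0 : 0 < eps / (c + A) by rewrite divr_gt0// ltr_pwDl.
  have [n Hn] := b_small _ d0.
  have Tn : `|T (xs n) - T (C0 l0)| <= A * b n.
    rewrite -linearB (le_trans (T_up _))// ler_wpM2l//; apply: c0_norm_le => k.
    exact: l_dist.
  have -> : y - T (C0 l0) = (y - T (xs n)) + (T (xs n) - T (C0 l0)).
    by rewrite addrA subrK.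
  rewrite (le_trans (ler_normD _ _))//.
  apply: (@le_trans _ _ (c * b n + A * b n)).
    rewrite lerD// (le_trans (Hxs n))// /b mulrC divfK ?gt_eqF//.
    by rewrite ler_peMl ?(ltW (inv0 n))// ler1n.
  by rewrite -mulrDl mulrC -ler_pdivlMr// ltr_pwDl.
- by move=> x; apply: T_inj; apply: HS; exists x.
- apply/subspace_continuousP => y ry; apply/cvgrPdist_le => eps eps0.
  rewrite near_withinE; near=> y' => ry'.
  apply: le_trans (T_dist _ _) _; rewrite HS// HS// ler_pdivrMr//.
  near: y'; apply: cvgr_dist_le => //; exact: mulr_gt0.
Unshelve. all: by end_near. Qed.

End linear_embeddings.

(** * Zones when bounded completeness fails *)

Section escaping_zones.
Context {R : realType} {E : normedModType R} (e : nat -> E).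
Hypothesis e0 : e 0%N != 0.

(** There are large tails beyond every [n]; a later tail is at most twice an earlier one, so with
    half the constant all tails are large. *)
Lemma not_boundedly_complete : ~ boundedly_complete e ->
  exists a (M delta : R), [/\ james_le e a M, 0 < delta &
    forall n, ~ james_le e (tailn n a) delta].
Proof.
move=> nbc; apply: contrapT => H; apply: nbc => a M aM eps eps0.
apply: contrapT => nn; apply: H; exists a, M, (eps / 2).
split => //; first by rewrite divr_gt0.
move=> n an; apply: nn; exists n => m nm.
rewrite -(tailn_tailn _ nm) (_ : eps = 2 * (eps / 2)); last by field.
exact: james_le_tailn.
Qed.

(** A James sum exceeding [delta] sees finitely many coordinates, so long heads share it. *)
Lemma james_le_tailn_headn (a : nat -> R) n delta : ~ james_le e (tailn n a) delta ->
  exists m0, forall m, (m0 <= m)%N -> ~ james_le e (tailn n (headn m a)) delta.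
Proof.
move=> nan; have [s [As sd]] : exists s,
    admissible 0 s /\ ~ `|james_sum e (tailn n a) s| <= delta.
  apply: contrapT => H; apply: nan => s As; apply: contrapT => nd.
  by apply: H; exists s.
exists (\max_(i <- s) i.2)%N => m sm /(_ s As).
rewrite tailn_headn (_ : james_sum e _ s = james_sum e (tailn n a) s)//.
rewrite /james_sum big_seq [RHS]big_seq; apply: eq_bigr => I sI.
rewrite isum_headn (minn_idPl _)//.
by apply: leq_trans sm; rewrite (big_rem _ sI)/= leq_maxl.
Qed.

(** Partial sums of [a] converge along [U], so the ends of a zone can be chosen with almost equal
    partial sums, at a precision fixed by the earlier [e p], and far enough apart for the zone to be
    large. *)
Lemma escaping_zones (a : nat -> R) M delta : james_le e a M ->
  (forall n, ~ james_le e (tailn n a) delta) ->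
  exists c d : nat -> nat, [/\ forall k, (c k < d k)%N, forall k, (d k <= c k.+1)%N,
    forall k p, (p < d k)%N ->
      `|isum a (c k.+1) (d k.+1)| * `|e p| <= 2^-1 ^+ k.+1 &
    forall k, ~ james_le e (tailn (c k) (headn (d k) a)) delta].
Proof.
move=> aM an.
have [U [UU Uoo]] := ultraFilterLemma (F := \oo) _.
have next (k d : nat) : exists cd : nat * nat, [/\ (d <= cd.1)%N, (cd.1 < cd.2)%N,
    forall p, (p < d)%N -> `|isum a cd.1 cd.2| * `|e p| <= 2^-1 ^+ k &
    ~ james_le e (tailn cd.1 (headn cd.2 a)) delta].
  pose w : R := 1 + \sum_(p < d) `|e p|.
  have w0 : 0 < w by rewrite ltr_pwDl// sumr_ge0.
  have x0 : 0 < 2^-1 ^+ k / w / 2 :> R by rewrite !divr_gt0// exprn_gt0.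
  have /cvgrPdist_le/(_ _ x0) Us := ulimsum_cvg (UU := UU) e0 aM.
  have [c [/= Hc dc]] := filter_ex (filterI Us (Uoo _ (nbhs_infty_ge d))).
  have [m0 Hm0] := james_le_tailn_headn (an c).
  have [d' [/= Hd' md]] := filter_ex (filterI Us (Uoo _ (nbhs_infty_ge (maxn m0 c.+1)))).
  have [md0 cd'] : (m0 <= d')%N /\ (c < d')%N.
    by split; apply: leq_trans md; rewrite ?leq_maxl ?leq_maxr.
  exists (c, d'); split => //=; last exact: Hm0.
  move=> p pd; have epw : `|e p| <= w by exact: norm_le_1Dsum.
  apply: (@le_trans _ _ (2^-1 ^+ k / w * w)); last by rewrite divfK ?gt_eqF.
  apply: ler_pM => //.
  have -> : isum a c d' = (ulimsum U a - isum a 0 c) - (ulimsum U a - isum a 0 d').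
    by rewrite (isum_cat a (leq0n c) (ltnW cd')); ring.
  rewrite (le_trans (ler_normB _ _))// [leRHS](splitr _) lerD//.
have /choice[f Hf] : forall kd : nat * nat, exists cd : nat * nat,
    [/\ (kd.2 <= cd.1)%N, (cd.1 < cd.2)%N,
      forall p, (p < kd.2)%N -> `|isum a cd.1 cd.2| * `|e p| <= 2^-1 ^+ kd.1 &
      ~ james_le e (tailn cd.1 (headn cd.2 a)) delta].
  by move=> [k d]; exact: next.
pose st := fix st k := if k is k'.+1 then f (k, (st k').2) else f (0%N, 0%N).
exists (fun k => (st k).1), (fun k => (st k).2); split.
- by case=> [|k] /=; [have [] := Hf (0%N, 0%N)|have [] := Hf (k.+1, (st k).2)].
- by move=> k /=; have [] := Hf (k.+1, (st k).2).
- by move=> k /=; have [] := Hf (k.+1, (st k).2).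
- by case=> [|k] /=; [have [] := Hf (0%N, 0%N)|have [] := Hf (k.+1, (st k).2)].
Qed.

End escaping_zones.

Lemma subrACA (V : zmodType) (a b c d : V) : (a - c) - (b - d) = (a - b) - (c - d).
Proof. by rewrite opprD addrACA -opprD. Qed.

(** * Transfer to the James space *)

Section james_space.
Context {R : realType} {E : normedModType R} (e : nat -> E).
Hypothesis e0 : e 0%N != 0.
Context (J : completeNormedModType R) (u : nat -> J) (hJ : is_james_space e u).

Let comb n (a : nat -> R) : J := \sum_(i < n) a i *: u i.

Let comb_james_le n a M : james_le e (headn n a) M <-> `|comb n a| <= M.
Proof.
rewrite james_norm_leP; have [<- _] := hJ.
by rewrite lee_fin.
Qed.

Let comb_headn m n a : (n <= m)%N -> comb m (headn n a) = comb n a.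
Proof.
move=> nm; rewrite /comb (big_ord_widen _ (fun i => a i *: u i) nm) [RHS]big_mkcond.
by apply: eq_bigr => i _; rewrite /headn; case: ifP; rewrite ?scale0r.
Qed.

(** The upper estimate is [james_le_zones], with errors that sum to at most 2. For the lower one,
    zone [l] is cut out of the sum; this at most doubles the norm, whence [delta / 2]. *)
Lemma not_boundedly_complete_c0 : ~ boundedly_complete e -> linearly_embeds (c0 R) J.
Proof.
move=> /not_boundedly_complete[a [M [delta [aM delta0 an]]]].
have [c [d [cd dc mass big]]] := escaping_zones e0 aM an.
have [cc dd dc'] := zones_ordered cd dc.
pose zone k := tailn (c k) (headn (d k) a).
pose z k := comb (d k) (zone k).
pose b (w : nat -> R) K j := \sum_(k < K) w k * zone k j.
have zE (w : nat -> R) K : \sum_(k < K) w k *: z k = comb (d K) (b w K).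
  rewrite /comb /b.
  under [RHS]eq_bigr => i _ do rewrite scaler_suml.
  rewrite exchange_big/=; apply: eq_bigr => k _.
  have -> : z k = comb (d K) (zone k).
    rewrite /z -(@comb_headn (d K) (d k)); last exact/dd/ltnW.
    by rewrite /zone tailn_headn headn_headn minnn.
  by rewrite /comb scaler_sumr; apply: eq_bigr => i _; rewrite scalerA.
apply: (@c0_embeds R J z (8 * M + 2) (delta / 2)); first by rewrite divr_gt0.
- move=> w K w1; rewrite zE; apply/comb_james_le; apply: james_le_headn.
  have pow0 k : 0 <= 2^-1 ^+ k :> R by rewrite exprn_ge0.
  have Z := james_le_zones (K := K) aM cd dc w1 pow0 (fun k p _ => mass k p).
  apply: james_leW Z; rewrite lerD2l.
  have -> : \sum_(k < K) 2^-1 ^+ k = 2 - 2 * 2^-1 ^+ K :> R.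
    elim: K => [|K IH]; first by rewrite big_ord0 expr0; ring.
    by rewrite big_ord_recr/= IH exprSr; field.
  by rewrite lerBlDr lerDl mulr_ge0.
- move=> w K l lK; rewrite zE; set N := `|comb _ _|.
  have [->|wl] := eqVneq (w l) 0; first by rewrite normr0 mulr0 /N.
  have bN : james_le e (headn (d K) (b w K)) N by exact/comb_james_le.
  have zl : tailn (c l) (headn (d l) (headn (d K) (b w K))) = w l \o* zone l.
    apply/funext => j; rewrite headn_headn (minn_idPl (dd _ _ (ltnW lK))).
    rewrite /tailn /headn /= mulrC; case: ltnP => cj; first by rewrite /zone /tailn cj mulr0.
    case: ltnP => jd; last by rewrite /zone /tailn /headn ltnNge cj/= ltnNge jd/= mulr0.
    rewrite /b (bigD1 (Ordinal lK))//= big1 ?addr0// => k kl.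
    have [kl'|lk|kl'] := ltngtP k l; last by rewrite -val_eqE /= kl' eqxx in kl.
      rewrite /zone /tailn /headn; have -> : (j < d k)%N = false.
        by apply/negbTE; rewrite -leqNgt (leq_trans (dc' _ _ kl')).
      by case: ifP; rewrite mulr0.
    by rewrite /zone /tailn (leq_trans jd (dc' _ _ lk)) mulr0.
  have := james_le_tailn (c l) (james_le_headn (d l) bN); rewrite zl.
  move=> /(james_leZ (w l)^-1).
  rewrite (_ : (w l)^-1 \o* _ = zone l); last first.
    by apply/funext => j /=; rewrite -mulrA divff// mulr1.
  move=> zN; rewrite leNgt; apply/negP => Nlt; apply: (big l).
  apply: james_leW zN; rewrite normfV ler_pdivrMl ?normr_gt0//.
  by move: Nlt; rewrite -/N; lra.
Qed.

(** Each [phi v] is replaced by a finite combination of the [u i] at distance less than 1, with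
    coefficients [psi v]; two such errors give the additive 2 in [no_coarse_map]. *)
Lemma boundedly_complete_no_coarse :
  boundedly_complete e -> ~ coarsely_embeds (c0 R) J.
Proof.
move=> bc [phi [rho [omega [_ homo rho_oo phi_ro]]]].
have /choice[na Hna] : forall v, exists na : nat * (nat -> R),
    `|phi v - comb na.1 na.2| < 1.
  move=> v; have [_ dense] := hJ.
  have [|x [vx [n [a xE]]]] := dense (ball (phi v) 1) _ (ball_open _ _).
    by exists (phi v); exact: ballxx.
  by exists (n, a); move: vx; rewrite -ball_normE /= xE.
pose psi v := headn (na v).1 (na v).2.
have psiE v w K : james_le e (psi v \- psi w) K <->
    `|comb (na v).1 (na v).2 - comb (na w).1 (na w).2| <= K.
  pose m := maxn (na v).1 (na w).1.
  have -> : psi v \- psi w = headn m (psi v \- psi w).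
    by rewrite headnB /psi !headn_headn (minn_idPr (leq_maxl _ _)) (minn_idPr (leq_maxr _ _)).
  rewrite comb_james_le (_ : comb m _ = comb m (psi v) - comb m (psi w)).
    by rewrite /psi !comb_headn ?leq_maxl ?leq_maxr.
  by rewrite /comb -sumrB; apply: eq_bigr => i _; rewrite scalerBl.
apply: (no_coarse_map e0 bc (psi := psi) homo rho_oo) => [v w|v w K /psiE vwK].
  apply/psiE; have /andP[_ vw] := phi_ro v w.
  have -> : comb (na v).1 (na v).2 - comb (na w).1 (na w).2 =
    (phi v - phi w) - ((phi v - comb (na v).1 (na v).2)
       - (phi w - comb (na w).1 (na w).2)).
    by rewrite [X in _ = _ - X]subrACA subKr.
  rewrite (le_trans (ler_normB _ _))// lerD// (le_trans (ler_normB _ _))//.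
  by have := Hna v; have := Hna w; lra.
have /andP[vw _] := phi_ro v w; apply: le_trans vw _.
have -> : phi v - phi w =
    (comb (na v).1 (na v).2 - comb (na w).1 (na w).2)
    + ((phi v - comb (na v).1 (na v).2) - (phi w - comb (na w).1 (na w).2)).
  by rewrite subrACA [RHS]addrC subrK.
rewrite (le_trans (ler_normD _ _))// lerD// (le_trans (ler_normB _ _))//.
by have := Hna v; have := Hna w; lra.
Qed.

End james_space.

(** If [e n] were 0, the unit sequence at [n] would be a second expansion of 0. *)
Lemma schauder_basis_neq0 (R : realType) (E : normedModType R) (e : nat -> E) n :
  schauder_basis e -> e n != 0.
Proof.
move=> /(_ 0)[a [a_cvg a_uniq]]; apply/eqP => en.
have a0 : a = fun=> 0.
  apply: a_uniq; rewrite (_ : series _ = fun=> 0); first exact: cvg_cst.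
  by apply/funext => m; rewrite /series /= big1// => i _; rewrite scale0r.
have := a_uniq (fun i => if i == n then 1 else 0).
move=> /(_ _)/(congr1 (fun f => f n)); rewrite a0 eqxx => H.
have /eqP : (0 : R) = 1.
  apply: H; rewrite (_ : series _ = fun=> 0); first exact: cvg_cst.
  apply/funext => m; rewrite /series /= big1// => i _.
  by case: eqP => [->|_]; rewrite ?en ?scaler0 ?scale0r.
by rewrite eq_sym oner_eq0.
Qed.

Theorem theorem29 (R : realType) (E : completeNormedModType R) (e : nat -> E)
  (he : unconditional_basis e)
  (J : completeNormedModType R) (u : nat -> J) (hJ : is_james_space e u) :
  coarsely_embeds (c0 R) J <-> linearly_embeds (c0 R) J.
Proof.
have e0 : e 0%N != 0 by exact: schauder_basis_neq0 he.1.
split; last exact: linear_coarse.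
move=> cJ; apply: (not_boundedly_complete_c0 e0 hJ) => bc.
by case: (boundedly_complete_no_coarse e0 hJ bc).
Qed.
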